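(* Let $\zeta\in(-1/2,\infty)$. Then there exist constants $c_1,\dots,c_8\in(0,\infty)$, depending only on $\zeta$, such that for all $r,s,t>0$, \[ c_1\, t^{-1/2}\frac{\exp\!\big(-\tfrac{(r-s)^2}{c_2 t}\big)}{(rs+t)^{\zeta}}\le p_\zeta^{(2)}(t,r,s)\le c_3\, t^{-1/2}\frac{\exp\!\big(-\tfrac{(r-s)^2}{c_4 t}\big)}{(rs+t)^{\zeta}}, \] and \[ c_5\, A_\zeta(t,r,s)\exp\!\Big(-\tfrac{(r-s)^2}{c_6 t}\Big)\le p_\zeta^{(2)}(t,r,s)\le c_7\, A_\zeta(t,r,s)\exp\!\Big(-\tfrac{(r-s)^2}{c_8 t}\Big), \] where $A_\zeta(t,r,s):=\big(1\wedge \tfrac{r}{t^{1/2}}\big)^{\zeta}\big(1\wedge \tfrac{s}{t^{1/2}}\big)^{\zeta}\big(\tfrac{1}{rs}\big)^{\zeta} t^{-1/2}$. Moreover, for every $\alpha\in(0,2)$ there is a constant $K\ge1$, depending only on $\zeta$ and $\alpha$, such that for all $r,s,t>0$, \[ K^{-1} Q\le p_\zeta^{(\alpha)}(t,r,s)\le K Q,\qquad Q:=\frac{t}{|r-s|^{1+\alpha}(r+s)^{2\zeta}+t^{\frac{1+\alpha}{\alpha}}\big(t^{\frac1\alpha}+r+s\big)^{2\zeta}}. \]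
   Context: For $z\in\mathbb{C}\setminus(-\infty,0]$ and $\nu\in\mathbb{C}$, $I_\nu$ denotes the modified Bessel function of the first kind of order $\nu$. For $\zeta\in(-1/2,\infty)$ the Bessel heat kernel is \[ p_\zeta^{(2)}(t,r,s):=\frac{(rs)^{1/2-\zeta}}{2t}\exp\Big(-\frac{r^2+s^2}{4t}\Big)I_{\zeta-1/2}\Big(\frac{rs}{2t}\Big),\quad r,s,t>0. \] For $\alpha\in(0,2)$ and $t>0$, let $\sigma_t^{(\alpha/2)}$ be the probability density on $(0,\infty)$ of the $\alpha/2$-stable subordinator, i.e. $e^{-t\lambda^{\alpha/2}}=\int_0^\infty e^{-\tau\lambda}\sigma_t^{(\alpha/2)}(\tau)\,d\tau$ for all $\lambda\ge0$. The subordinated Bessel heat kernel is $p_\zeta^{(\alpha)}(t,r,s):=\int_0^\infty p_\zeta^{(2)}(\tau,r,s)\,\sigma_t^{(\alpha/2)}(\tau)\,d\tau$ for $r,s,t>0$. Notation: $a\wedge b=\min\{a,b\}$. *)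

(* Defs.v *)
From Stdlib Require Import Reals.
From Coquelicot Require Import Coquelicot.
Open Scope R_scope.

(* Real power x^y for x >= 0, with the convention 0^y = 0 (used only with y > 0). *)
Definition rpow (x y : R) : R := if Rle_dec x 0 then 0 else Rpower x y.

Definition Gamma (x : R) : R :=
  RInt_gen (fun u => Rpower u (x - 1) * exp (- u)) (at_right 0) (Rbar_locally p_infty).

Definition BesselI (nu x : R) : R :=
  Series (fun k => Rpower (x / 2) (2 * INR k + nu) / (INR (Factorial.fact k) * Gamma (INR k + nu + 1))).

Definition p2 (zeta t r s : R) : R :=
  Rpower (r * s) (1/2 - zeta) / (2 * t) * exp (- (r ^ 2 + s ^ 2) / (4 * t))
  * BesselI (zeta - 1/2) (r * s / (2 * t)).

(* sigma is (a version of) the family of densities on (0,oo) of the alpha/2-stable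
   subordinator: sigma t is nonnegative on (0,oo) and its Laplace transform is
   exp(-t lambda^(alpha/2)) for every lambda >= 0 (lambda = 0 gives total mass 1). *)
Definition stable_subordinator_density (alpha : R) (sigma : R -> R -> R) : Prop :=
  forall t, 0 < t ->
    (forall tau, 0 < tau -> 0 <= sigma t tau) /\
    (forall lambda, 0 <= lambda ->
       is_RInt_gen (fun tau => exp (- (tau * lambda)) * sigma t tau)
         (at_right 0) (Rbar_locally p_infty)
         (exp (- (t * rpow lambda (alpha / 2))))).

Definition palpha (zeta : R) (sigma : R -> R -> R) (t r s : R) : R :=
  RInt_gen (fun tau => p2 zeta tau r s * sigma t tau) (at_right 0) (Rbar_locally p_infty).

Definition Azeta (zeta t r s : R) : R :=
  Rpower (Rmin 1 (r / sqrt t)) zeta * Rpower (Rmin 1 (s / sqrt t)) zeta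
  * Rpower (/ (r * s)) zeta * Rpower t (- (1/2)).

Definition Qalpha (zeta alpha t r s : R) : R :=
  t / (rpow (Rabs (r - s)) (1 + alpha) * Rpower (r + s) (2 * zeta)
       + Rpower t ((1 + alpha) / alpha) * Rpower (Rpower t (1 / alpha) + r + s) (2 * zeta)).

(* Main.v *)
Require Import Defs.
From Stdlib Require Import Reals Lra Lia Classical IndefiniteDescription.
From Coquelicot Require Import Coquelicot.
Open Scope R_scope.

(** For [nu = zeta - 1/2] the coefficients of the Bessel series satisfy
    [k! Gamma(k+nu+1) 4^k ~ (2k)! (k+1)^zeta], because the ratio of consecutive quotients is
    [1 + zeta/(k+1/2)].  Hence the series is comparable with [sum x^(2k)/(2k)! (k+1)^(-zeta)], and
    as the weights [x^(2k)/(2k)!] concentrate at [k ~ x], the latter is of order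
    [(1+x)^(-zeta) e^x].  This gives the Gaussian bounds with [(r-s)^2/(4t)] in both exponentials;
    the bounds with [A_zeta] follow since replacing [rs + t] costs at most a power of
    [1 + |r-s|/sqrt t].

    Only the Laplace transform of the stable density is available, so every bound of
    [int p2 sigma] is reduced to pointwise bounds of [p2] by combinations of exponentials
    [exp(-lambda tau)], which integrate exactly.  Let [T = t^(2/alpha)] and
    [m = max(T, (r-s)^2)]; the kernel [Q] is comparable with [t m^(-alpha/2)] times the diagonal
    kernel at time [m].  From above, [p2] is dominated by [1 - exp(-tau/m)] when [m = (r-s)^2], and
    by [1 + (m/tau)^n], which is itself dominated by a sum of exponentials, when [m = T].  From
    below, it suffices that [sigma_t] has mass of order [t m^(-alpha/2)] near [m]. *)

(** * Improper and Riemann integrals *)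

(** Beyond its sign and the convergence of its Laplace integrals nothing is known of [sigma t]: it
    is Riemann integrable on compact subintervals of the open half-line, and no continuity is
    available. Products with [p2] therefore need an integrability lemma, which rests on the
    continuity of [p2] in time, and convergence of the integral in [palpha] has to be proved before
    its value can be used. As [K] is chosen before [sigma], every constant comes from the Laplace
    transform alone.

    The factor [t m^(-alpha/2)] is the exponent of that transform at [lambda = 1/m]. It is at most 1
    because [m >= T], so [1 - exp(-t lambda^(alpha/2))] is comparable with it.

    Concentration of the weights at [k ~ x] is used only through two moments of [u = (k+1)/(1+x)],
    namely those of [u] and of [u^(-2q)]. They suffice because [u^(-zeta)] lies below [u + u^(-2q)]
    and, up to a constant factor, above [1 - u^(-2)/C - u/C]. Both moments reduce to the series of
    [cosh], at a slightly larger argument or with shifted index. *)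

Lemma ex_RInt_subinterval (f : R -> R) (a b c d : R) :
  a <= c -> c <= d -> d <= b -> ex_RInt f a b -> ex_RInt f c d.
Proof.
  intros Hac Hcd Hdb H.
  apply (ex_RInt_Chasles_2 f a c d); [lra|].
  apply (ex_RInt_Chasles_1 f a d b); [lra|exact H].
Qed.

Lemma RInt_subinterval_le (f : R -> R) (a b c d : R) :
  a <= c -> c <= d -> d <= b -> ex_RInt f a b ->
  (forall x, a < x < b -> 0 <= f x) -> RInt f c d <= RInt f a b.
Proof.
  intros Hac Hcd Hdb H Hf.
  assert (H1 : ex_RInt f a c) by (apply (ex_RInt_subinterval f a b); lra || assumption).
  assert (H2 : ex_RInt f c d) by (apply (ex_RInt_subinterval f a b); lra || assumption).
  assert (H3 : ex_RInt f d b) by (apply (ex_RInt_subinterval f a b); lra || assumption).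
  rewrite <- (RInt_Chasles f a c b), <- (RInt_Chasles f c d b); trivial.
  2: now apply (ex_RInt_Chasles f c d b).
  change (RInt f c d <= RInt f a c + (RInt f c d + RInt f d b)).
  assert (0 <= RInt f a c) by (apply RInt_ge_0; [lra|assumption|intros; apply Hf; lra]).
  assert (0 <= RInt f d b) by (apply RInt_ge_0; [lra|assumption|intros; apply Hf; lra]).
  lra.
Qed.

Lemma filter_prod_right0_pinfty (a b : R) :
  0 < a ->
  filter_prod (at_right 0) (Rbar_locally p_infty)
    (fun ab => 0 < fst ab < a /\ b < snd ab).
Proof.
  intros Ha.
  apply (Filter_prod _ _ _ (fun x => 0 < x < a) (fun y => b < y)).
  - exists (mkposreal a Ha). intros y Hy Hy0. unfold ball in Hy. simpl in Hy.
    unfold AbsRing_ball, abs, minus, plus, opp in Hy. simpl in Hy.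
    apply Rabs_def2 in Hy. lra.
  - now exists b.
  - now simpl.
Qed.

(** Convergence along the product filter forces integrability on some interval reaching beyond both
    [a] and [b], and this passes to subintervals. It is the only source of regularity for the stable
    density. *)
Lemma is_RInt_gen_ex_RInt (f : R -> R) (l a b : R) :
  is_RInt_gen f (at_right 0) (Rbar_locally p_infty) l ->
  0 < a -> a <= b -> ex_RInt f a b.
Proof.
  intros H Ha Hab.
  assert (H1 : filter_prod (at_right 0) (Rbar_locally p_infty)
    (fun ab => ex_RInt f (fst ab) (snd ab))).
  { apply (filter_imp (F := filter_prod (at_right 0) (Rbar_locally p_infty))
      (fun ab => exists y, is_RInt f (fst ab) (snd ab) y /\ True)).
    - intros x [y [Hy _]]. now exists y.
    - apply (H (fun _ => True)). apply filter_true. }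
  destruct (filter_ex _ (filter_and _ _ H1 (filter_prod_right0_pinfty a b Ha)))
    as [[x y] [Hx [Hy1 Hy2]]]. simpl in *.
  apply (ex_RInt_subinterval f x y); lra || assumption.
Qed.

Lemma is_RInt_gen_lim (f : R -> R) (l : R) :
  is_RInt_gen f (at_right 0) (Rbar_locally p_infty) l ->
  forall eps, 0 < eps -> forall a0 b0, 0 < a0 ->
  exists a b, 0 < a < a0 /\ b0 < b /\ Rabs (RInt f a b - l) < eps.
Proof.
  intros H eps Heps a0 b0 Ha0.
  specialize (H (fun y => Rabs (y - l) < eps)).
  assert (H1 : locally l (fun y => Rabs (y - l) < eps)).
  { exists (mkposreal eps Heps). intros y Hy. exact Hy. }
  specialize (H H1). unfold filtermapi in H.
  destruct (filter_ex _ (filter_and _ _ H (filter_prod_right0_pinfty a0 b0 Ha0)))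
    as [[x y] [[z [Hz1 Hz2]] [Hy1 Hy2]]]. simpl in *.
  exists x, y. repeat split; try tauto. now rewrite (is_RInt_unique _ _ _ _ Hz1).
Qed.

Lemma is_RInt_gen_nonneg_ub (f : R -> R) (l a b : R) :
  (forall x, 0 < x -> 0 <= f x) ->
  is_RInt_gen f (at_right 0) (Rbar_locally p_infty) l ->
  0 < a -> a <= b -> RInt f a b <= l.
Proof.
  intros Hf H Ha Hab. apply Rnot_lt_le. intros Hl.
  destruct (is_RInt_gen_lim f l H (RInt f a b - l) ltac:(lra) a b Ha)
    as [x [y [Hx [Hy Hxy]]]].
  assert (RInt f a b <= RInt f x y).
  { apply RInt_subinterval_le; try lra.
    - apply (is_RInt_gen_ex_RInt f l); lra || assumption.
    - intros; apply Hf; lra. }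
  apply Rabs_def2 in Hxy. lra.
Qed.

Lemma is_RInt_gen_le_bound (f : R -> R) (l M : R) :
  is_RInt_gen f (at_right 0) (Rbar_locally p_infty) l ->
  (exists a0 b0, 0 < a0 /\ forall a b, 0 < a < a0 -> b0 < b -> RInt f a b <= M) -> l <= M.
Proof.
  intros H [a0 [b0 [Ha0 HM]]]. apply Rnot_lt_le. intros Hl.
  destruct (is_RInt_gen_lim f l H (l - M) ltac:(lra) a0 b0 Ha0)
    as [x [y [Hx [Hy Hxy]]]].
  specialize (HM x y Hx Hy). apply Rabs_def2 in Hxy. lra.
Qed.

(** For a nonnegative integrand the integrals over compact intervals increase with the interval, so
    they converge to their supremum. This certifies that [RInt_gen] denotes a genuine limit. *)
Lemma is_RInt_gen_nonneg_bounded (f : R -> R) (M : R) :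
  (forall x, 0 < x -> 0 <= f x) ->
  (forall a b, 0 < a -> a <= b -> ex_RInt f a b) ->
  (forall a b, 0 < a -> a <= b -> RInt f a b <= M) ->
  is_RInt_gen f (at_right 0) (Rbar_locally p_infty)
    (RInt_gen f (at_right 0) (Rbar_locally p_infty)) /\
  RInt_gen f (at_right 0) (Rbar_locally p_infty) <= M /\
  (forall a b, 0 < a -> a <= b ->
     RInt f a b <= RInt_gen f (at_right 0) (Rbar_locally p_infty)).
Proof.
  intros Hf Hex HM.
  destruct (completeness (fun y => exists a b, 0 < a /\ a <= b /\ y = RInt f a b)) as [l [Hl1 Hl2]].
  { exists M. intros y [a [b [Ha [Hab ->]]]]. auto. }
  { exists (RInt f 1 1), 1, 1. repeat split; lra. }
  assert (H : is_RInt_gen f (at_right 0) (Rbar_locally p_infty) l).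
  { intros P [eps HP].
    assert (Hex2 : exists a b, 0 < a /\ a <= b /\ l - eps < RInt f a b).
    { apply NNPP. intros Hn.
      assert (l <= l - eps); [|destruct eps; simpl in *; lra].
      apply Hl2. intros y [a [b [Ha [Hab ->]]]]. apply Rnot_lt_le. intros Hy.
      apply Hn. now exists a, b. }
    destruct Hex2 as [a [b [Ha [Hab Hlt]]]].
    unfold filtermapi. generalize (filter_prod_right0_pinfty a b Ha). apply filter_imp.
    intros [x y] [Hx Hy]. simpl in *. exists (RInt f x y). split.
    - apply (RInt_correct f). apply Hex; lra.
    - apply HP. change (Rabs (RInt f x y - l) < eps).
      assert (RInt f x y <= l) by (apply Hl1; exists x, y; repeat split; lra).
      assert (RInt f a b <= RInt f x y).
      { apply RInt_subinterval_le; try lra. apply Hex; lra. intros; apply Hf; lra. }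
      apply Rabs_def1; lra. }
  rewrite (is_RInt_gen_unique f l H). repeat split; trivial.
  - apply Hl2. intros y [a [b [Ha [Hab ->]]]]. auto.
  - intros a b Ha Hab. apply Hl1. now exists a, b.
Qed.

Lemma ex_RInt_uniform_approx (h : R -> R) (a b : R) :
  a <= b ->
  (forall eps, 0 < eps -> exists g, ex_RInt g a b /\
     forall x, a <= x <= b -> Rabs (h x - g x) <= eps) ->
  ex_RInt h a b.
Proof.
  intros Hab H.
  assert (H' : forall n : nat, exists g : R -> R, ex_RInt g a b /\
     forall x, Rabs (h x - g x) <= / (INR n + 1)).
  { intros n. destruct (H (/ (INR n + 1))) as [g [Hg1 Hg2]].
    { apply Rinv_0_lt_compat. generalize (pos_INR n); lra. }
    (* [filterlim_RInt] is applied with uniform convergence on the whole line, so the approximant is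
       replaced by [h] itself outside [[a, b]]. *)
    exists (fun x => if Rle_dec a x then if Rle_dec x b then g x else h x else h x). split.
    - apply (ex_RInt_ext g); trivial. rewrite Rmin_left, Rmax_right by lra.
      intros x Hx. destruct (Rle_dec a x); [|lra]. destruct (Rle_dec x b); lra.
    - assert (0 <= / (INR n + 1)).
      { left; apply Rinv_0_lt_compat. generalize (pos_INR n); lra. }
      intros x. destruct (Rle_dec a x); [destruct (Rle_dec x b)|].
      + auto.
      + now rewrite Rminus_diag, Rabs_R0.
      + now rewrite Rminus_diag, Rabs_R0. }
  destruct (functional_choice _ H') as [g Hg].
  destruct (filterlim_RInt g a b eventually _ h (fun n => RInt (g n) a b)) as [I [_ HI]].
  - intros n. apply (RInt_correct (g n)), Hg.
  - intros P [eps HP].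
    destruct (nfloor_ex (/ eps)) as [N HN].
    { left; apply Rinv_0_lt_compat, cond_pos. }
    exists N. intros n Hn. apply HP. intros x.
    change (Rabs (g n x - h x) < eps). rewrite Rabs_minus_sym.
    apply Rle_lt_trans with (1 := proj2 (Hg n) x).
    rewrite <- (Rinv_inv eps). apply Rinv_lt_contravar.
    + apply Rmult_lt_0_compat. apply Rinv_0_lt_compat, cond_pos.
      generalize (pos_INR n); lra.
    + apply le_INR in Hn. lra.
  - now exists I.
Qed.

(** On a fine mesh [f] is uniformly close to a step function, a step function times [g] is
    integrable, and [g] is bounded. Hence [f * g] is a uniform limit of integrable functions. *)
Lemma ex_RInt_continuous_mult (f g : R -> R) (a b : R) :
  a <= b ->
  (forall x, a <= x <= b -> continuous f x) -> ex_RInt g a b ->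
  ex_RInt (fun x => f x * g x) a b.
Proof.
  intros Hab Hf Hg.
  destruct (ex_RInt_ub g a b Hg) as [M HM].
  rewrite Rmin_left, Rmax_right in HM by lra.
  assert (HM0 : 0 <= M). { apply Rle_trans with (norm (g a)). apply norm_ge_0. apply HM; lra. }
  apply ex_RInt_uniform_approx; trivial. intros eps Heps.
  assert (Hd : 0 < eps / (M + 1)) by (apply Rdiv_lt_0_compat; lra).
  destruct (unifcont_normed_1d f a b Hf (mkposreal _ Hd)) as [d Hunif].
  (* The approximant is built from left to right: an interval covered by [n] cells of length [d / 2]
     is extended by one cell, on which [f] is frozen at the left end of the cell. *)
  assert (HP : forall n : nat, forall c, a <= c <= b -> c - a <= INR n * (d / 2) ->
    exists k, ex_RInt k a c /\ forall x, a <= x <= c -> Rabs (f x * g x - k x) <= eps).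
  { assert (Hbase : forall c e x, a <= c <= b -> a <= e <= b -> c <= x <= e -> e - c <= d / 2 ->
      Rabs (f x * g x - f c * g x) <= eps).
    { intros c e x Hc He Hx Hec.
      rewrite <- Rmult_minus_distr_r, Rabs_mult.
      assert (Hfx : Rabs (f x - f c) < eps / (M + 1)).
      { apply (Hunif c x); try lra. change (Rabs (x - c) < d).
        rewrite Rabs_pos_eq by lra. destruct d as [d Hd0]; simpl in *; lra. }
      assert (Hgx : Rabs (g x) <= M) by (apply HM; lra).
      apply Rle_trans with (eps / (M + 1) * M).
      - apply Rmult_le_compat; try apply Rabs_pos; lra.
      - replace (eps / (M + 1) * M) with (eps - eps / (M + 1)) by (field; lra). lra. }
    induction n as [|n IH]; intros c Hc Hn.
    - simpl in Hn. assert (c = a) by lra. subst c. exists (fun x => f x * g x).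
      split; [apply ex_RInt_point|]. intros. rewrite Rminus_diag, Rabs_R0. lra.
    - rewrite S_INR in Hn.
      destruct (Rle_dec c (a + INR n * (d / 2))) as [Hle|Hgt]; [apply IH; lra|].
      set (c' := a + INR n * (d / 2)) in *.
      assert (Hc' : a <= c').
      { unfold c'. assert (0 <= INR n * (d / 2)); [|lra]. apply Rmult_le_pos. apply pos_INR.
        destruct d; simpl; lra. }
      destruct (IH c') as [k [Hk1 Hk2]]; [lra|unfold c'; lra|].
      exists (fun x => if Rle_dec x c' then k x else f c' * g x). split.
      + apply (ex_RInt_Chasles _ a c' c).
        * apply (ex_RInt_ext k); trivial. rewrite Rmin_left, Rmax_right by lra.
          intros x Hx. destruct (Rle_dec x c'); lra.
        * apply (ex_RInt_ext (fun x => scal (f c') (g x))).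
          -- rewrite Rmin_left, Rmax_right by lra.
             intros x Hx. destruct (Rle_dec x c'); [lra|reflexivity].
          -- apply (ex_RInt_scal g). apply (ex_RInt_subinterval g a b); lra || assumption.
      + intros x Hx. destruct (Rle_dec x c'). apply Hk2; lra.
        apply (Hbase c' c); try lra. unfold c'. lra. }
  destruct (nfloor_ex ((b - a) / (d / 2))) as [N HN].
  { apply Rmult_le_pos. lra. left; apply Rinv_0_lt_compat. destruct d; simpl; lra. }
  apply (HP (S N)); [lra|]. rewrite S_INR.
  assert (0 < d / 2) by (destruct d; simpl; lra).
  replace (b - a) with ((b - a) / (d / 2) * (d / 2)) by (field; destruct d; simpl in *; lra).
  apply Rmult_le_compat_r; lra.
Qed.

Lemma RInt_lincomb2 (f g : R -> R) (a b c d : R) :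
  ex_RInt f a b -> ex_RInt g a b ->
  is_RInt (fun x => c * f x + d * g x) a b (c * RInt f a b + d * RInt g a b).
Proof.
  intros Hf Hg.
  apply (is_RInt_plus (fun x => c * f x) (fun x => d * g x) a b).
  - apply (is_RInt_scal f), (RInt_correct f), Hf.
  - apply (is_RInt_scal g), (RInt_correct g), Hg.
Qed.

(** * Real powers *)

Lemma Rpower_pos (x y : R) : 0 < Rpower x y.
Proof. apply exp_pos. Qed.

Lemma exp_le (x y : R) : x <= y -> exp x <= exp y.
Proof. intros [H|H]; [left; now apply exp_increasing|right; now rewrite H]. Qed.

Lemma ln_le_sub1 (x : R) : 0 < x -> ln x <= x - 1.
Proof.
  intros Hx. rewrite <- (ln_exp (x - 1)). apply ln_le; trivial.
  generalize (exp_ineq1_le (x - 1)); lra.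
Qed.

(** The two comparisons say [|ln x - ln y| <= ln C], which is symmetric, so the conclusion covers
    exponents of either sign. *)
Lemma Rpower_compare (C x y z : R) :
  0 < x -> 0 < y -> x <= C * y -> y <= C * x ->
  Rpower x z <= Rpower C (Rabs z) * Rpower y z.
Proof.
  intros Hx Hy H1 H2.
  assert (HC : 0 < C) by (apply (Rmult_lt_reg_r y); lra).
  unfold Rpower. rewrite <- exp_plus. apply exp_le.
  apply ln_le in H1; trivial. apply ln_le in H2; trivial.
  rewrite ln_mult in H1, H2 by trivial.
  assert (H : z * (ln x - ln y) <= Rabs z * ln C); [|lra].
  apply Rle_trans with (Rabs (z * (ln x - ln y))); [apply Rle_abs|].
  rewrite Rabs_mult. apply Rmult_le_compat_l. apply Rabs_pos.
  apply Rabs_le. lra.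
Qed.

(** The tangent line of [ln] at [2 (N + 1)] gives [N ln y <= N ln (2 (N + 1)) + y / 2]. The spare
    half of the exponent is spent later against [exp (- y)]. *)
Lemma Rpower_le_exp (N y : R) :
  0 <= N -> 0 < y -> Rpower y N <= Rpower (2 * (N + 1)) N * exp (y / 2).
Proof.
  intros HN Hy. unfold Rpower. rewrite <- exp_plus. apply exp_le.
  assert (Ha : 0 < 2 * (N + 1)) by lra.
  assert (H : ln (y / (2 * (N + 1))) <= y / (2 * (N + 1)) - 1).
  { apply ln_le_sub1. now apply Rdiv_lt_0_compat. }
  rewrite ln_div in H by trivial.
  apply (Rmult_le_compat_l N) in H; trivial.
  assert (H2 : N * (y / (2 * (N + 1))) <= y / 2).
  { replace (N * (y / (2 * (N + 1)))) with (y / 2 - y / (2 * (N + 1))) by (field; lra).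
    assert (0 < y / (2 * (N + 1))) by now apply Rdiv_lt_0_compat. lra. }
  lra.
Qed.

Lemma Rpower_ge1 (x y : R) : 1 <= x -> 0 <= y -> 1 <= Rpower x y.
Proof.
  intros Hx Hy. rewrite <- (Rpower_O x) by lra. now apply Rle_Rpower.
Qed.

Lemma Rpower_le1 (x y : R) : 1 <= x -> y <= 0 -> Rpower x y <= 1.
Proof.
  intros Hx Hy. rewrite <- (Rpower_O x) by lra. now apply Rle_Rpower.
Qed.

Lemma Rpower_Rinv (x y : R) : 0 < x -> Rpower (/ x) y = Rpower x (- y).
Proof.
  intros Hx. unfold Rpower. rewrite ln_Rinv by trivial. f_equal; ring.
Qed.

Lemma Rpower_Rdiv (x y z : R) : 0 < x -> 0 < y ->
  Rpower (x / y) z = Rpower x z / Rpower y z.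
Proof.
  intros Hx Hy. unfold Rdiv.
  rewrite <- Rpower_mult_distr, Rpower_Rinv, Rpower_Ropp; auto with real.
Qed.

(** * The Gamma function *)

Definition Gamma_integrand (x u : R) : R := Rpower u (x - 1) * exp (- u).

Lemma Gamma_integrand_pos (x u : R) : 0 < Gamma_integrand x u.
Proof. apply Rmult_lt_0_compat; apply exp_pos. Qed.

Lemma Gamma_integrand_continuous (x u : R) : 0 < u -> continuous (Gamma_integrand x) u.
Proof.
  intros Hu. apply (ex_derive_continuous (Gamma_integrand x)).
  unfold Gamma_integrand, Rpower. auto_derive; trivial.
Qed.

Lemma ex_RInt_Gamma_integrand (x a b : R) :
  0 < a -> a <= b -> ex_RInt (Gamma_integrand x) a b.
Proof.
  intros Ha Hab. apply (ex_RInt_continuous (Gamma_integrand x)).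
  rewrite Rmin_left, Rmax_right by lra.
  intros z Hz. apply Gamma_integrand_continuous; lra.
Qed.

(* Compare with [u^(x-1) (1+u)^(-x-1)], whose primitive is [(u/(1+u))^x / x]. *)
Lemma RInt_Gamma_integrand_bounded (x : R) :
  0 < x -> exists M, forall a b, 0 < a -> a <= b -> RInt (Gamma_integrand x) a b <= M.
Proof.
  intros Hx.
  (* Chosen so that [(1+u)^(x+1) e^(-u) <= C]: [Rpower_le_exp] at [y = 1 + u] leaves
     [exp ((1+u)/2 - u)], at most [exp (1/2)]. *)
  set (C := Rpower (2 * (x + 1 + 1)) (x + 1) * exp (1 / 2)).
  assert (HC : 0 < C) by (apply Rmult_lt_0_compat; apply exp_pos).
  set (g := fun u => C * (Rpower u (x - 1) * Rpower (1 + u) (- x - 1))).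
  set (h := fun u => C / x * Rpower (u / (1 + u)) x).
  exists (C / x). intros a b Ha Hab.
  assert (Hg : is_RInt g a b (minus (h b) (h a))).
  { apply (is_RInt_derive h g); rewrite Rmin_left, Rmax_right by lra; intros u Hu.
    - unfold h, g, Rpower. auto_derive.
      + repeat split; try lra. apply Rdiv_lt_0_compat; lra.
      + replace (u * / (1 + u)) with (u / (1 + u)) by reflexivity.
        rewrite (ln_div u (1 + u)) by lra.
        replace ((x - 1) * ln u) with (x * ln u + - ln u) by ring.
        replace ((- x - 1) * ln (1 + u)) with (- (x * ln (1 + u)) + - ln (1 + u)) by ring.
        replace (x * (ln u - ln (1 + u))) with (x * ln u + - (x * ln (1 + u))) by ring.
        rewrite !exp_plus, !exp_Ropp, !exp_ln by lra. field.
        repeat split; try lra. apply Rgt_not_eq, exp_pos.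
    - apply (ex_derive_continuous g). unfold g, Rpower. auto_derive; lra. }
  assert (Hle : RInt (Gamma_integrand x) a b <= RInt g a b).
  { apply RInt_le; trivial.
    - now apply ex_RInt_Gamma_integrand.
    - now exists (minus (h b) (h a)).
    - intros u Hu. unfold Gamma_integrand, g.
      assert (H := Rpower_le_exp (x + 1) (1 + u) ltac:(lra) ltac:(lra)).
      rewrite (Rmult_comm C), Rmult_assoc. apply Rmult_le_compat_l. left; apply exp_pos.
      replace (- x - 1) with (- (x + 1)) by ring.
      rewrite Rpower_Ropp.
      assert (HP := Rpower_pos (1 + u) (x + 1)).
      apply (Rmult_le_reg_l (Rpower (1 + u) (x + 1))); trivial.
      rewrite <- Rmult_assoc, Rinv_r, Rmult_1_l by lra.
      apply Rle_trans with (Rpower (2 * (x + 1 + 1)) (x + 1) * exp ((1 + u) / 2) * exp (- u)).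
      { apply Rmult_le_compat_r; trivial. left; apply exp_pos. }
      unfold C. rewrite !Rmult_assoc. apply Rmult_le_compat_l. left; apply exp_pos.
      rewrite <- exp_plus. apply exp_le. lra. }
  apply Rle_trans with (1 := Hle). rewrite (is_RInt_unique _ _ _ _ Hg).
  change (h b - h a <= C / x). unfold h.
  assert (HCx : 0 < C / x) by now apply Rdiv_lt_0_compat.
  assert (H1 : Rpower (b / (1 + b)) x <= 1).
  { unfold Rpower. apply Rle_trans with (exp 0); [|rewrite exp_0; lra]. apply exp_le.
    assert (ln (b / (1 + b)) <= 0); [|nra].
    rewrite <- ln_1. apply ln_le. apply Rdiv_lt_0_compat; lra.
    apply Rle_div_l; lra. }
  assert (H2 := Rpower_pos (a / (1 + a)) x). nra.
Qed.

Lemma Gamma_correct (x : R) : 0 < x ->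
  is_RInt_gen (Gamma_integrand x) (at_right 0) (Rbar_locally p_infty) (Gamma x).
Proof.
  intros Hx. destruct (RInt_Gamma_integrand_bounded x Hx) as [M HM].
  apply (is_RInt_gen_nonneg_bounded (Gamma_integrand x) M); trivial.
  - intros; left; apply Gamma_integrand_pos.
  - apply ex_RInt_Gamma_integrand.
Qed.

Lemma Gamma_pos (x : R) : 0 < x -> 0 < Gamma x.
Proof.
  intros Hx. apply Rlt_le_trans with (RInt (Gamma_integrand x) 1 2).
  - apply RInt_gt_0; [lra| |].
    + intros; apply Gamma_integrand_pos.
    + intros; apply Gamma_integrand_continuous; lra.
  - apply (is_RInt_gen_nonneg_ub (Gamma_integrand x)); try lra.
    + intros; left; apply Gamma_integrand_pos.
    + now apply Gamma_correct.
Qed.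

(** Integration by parts: [u^x e^(-u) - x u^(x-1) e^(-u)] has the primitive [- u^x e^(-u)], which
    vanishes at both ends. *)
Lemma Gamma_succ (x : R) : 0 < x -> Gamma (x + 1) = x * Gamma x.
Proof.
  intros Hx.
  set (f := fun u => Gamma_integrand (x + 1) u - x * Gamma_integrand x u).
  assert (Hl : is_RInt_gen f (at_right 0) (Rbar_locally p_infty) (Gamma (x + 1) - x * Gamma x)).
  { apply (is_RInt_gen_minus (Gamma_integrand (x + 1)) (fun u => x * Gamma_integrand x u)).
    - apply Gamma_correct; lra.
    - apply (is_RInt_gen_scal (Gamma_integrand x)). now apply Gamma_correct. }
  set (h := fun u => - (Rpower u x * exp (- u))).
  assert (Hh : forall a b, 0 < a -> a <= b -> RInt f a b = h b - h a).
  { intros a b Ha Hab. apply is_RInt_unique.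
    apply (is_RInt_derive h f); rewrite Rmin_left, Rmax_right by lra; intros u Hu.
    - unfold h, f, Gamma_integrand, Rpower. auto_derive; [lra|].
      replace ((x - 1) * ln u) with (x * ln u + - ln u) by ring.
      replace (x + 1 - 1) with x by ring.
      rewrite exp_plus, !exp_Ropp, exp_ln by lra. field.
      split; [apply Rgt_not_eq, exp_pos|lra].
    - apply (ex_derive_continuous f). unfold f, Gamma_integrand, Rpower. auto_derive; lra. }
  apply Rminus_diag_uniq, NNPP. intros Hne.
  set (l := Gamma (x + 1) - x * Gamma x) in *.
  assert (He : 0 < Rabs l) by now apply Rabs_pos_lt.
  set (C := Rpower (2 * (x + 1)) x). assert (HC : 0 < C) by apply Rpower_pos.
  set (e := Rabs l / 3). assert (He3 : 0 < e) by (unfold e; lra).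
  (* If [l] were nonzero, take [e = |l| / 3]. Then [a < e^(1/x)] makes the boundary term at [a] at
     most [e], and [b > 2 ln (C/e)] does so at [b]; the first entry of the maximum ensures [a < b].
     Altogether [|l| <= 2 e], a contradiction. *)
  destruct (is_RInt_gen_lim f l Hl e He3 (Rpower e (/ x)) (Rmax (Rpower e (/ x)) (2 * ln (C / e))))
    as [a [b [Ha [Hb H]]]]; [apply Rpower_pos|].
  assert (Hb1 := Rmax_l (Rpower e (/ x)) (2 * ln (C / e))).
  assert (Hb2 := Rmax_r (Rpower e (/ x)) (2 * ln (C / e))).
  rewrite Hh in H by lra. unfold h in H.
  assert (H1 : Rpower a x * exp (- a) <= e).
  { rewrite <- (Rpower_1 e) at 1 by trivial.
    replace 1 with (/ x * x) by (field; lra). rewrite <- Rpower_mult.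
    apply Rle_trans with (Rpower a x * 1).
    - apply Rmult_le_compat_l. left; apply Rpower_pos. rewrite <- exp_0. apply exp_le; lra.
    - rewrite Rmult_1_r. apply Rle_Rpower_l; lra. }
  assert (H2 : Rpower b x * exp (- b) <= e).
  { apply Rle_trans with (C * exp (b / 2) * exp (- b)).
    - apply Rmult_le_compat_r. left; apply exp_pos. apply Rpower_le_exp; lra.
    - rewrite Rmult_assoc, <- exp_plus.
      apply Rle_trans with (C * exp (- ln (C / e))).
      + apply Rmult_le_compat_l; [lra|]. apply exp_le. lra.
      + rewrite exp_Ropp, exp_ln by now apply Rdiv_lt_0_compat. right; field; lra. }
  assert (H3 : 0 < Rpower a x * exp (- a)) by (apply Rmult_lt_0_compat; apply exp_pos).
  assert (H4 : 0 < Rpower b x * exp (- b)) by (apply Rmult_lt_0_compat; apply exp_pos).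
  assert (Rabs l <= e + e).
  { apply Rabs_def2 in H. apply Rabs_le. lra. }
  unfold e in *. lra.
Qed.

(** * Growth of the Bessel coefficients *)

(** Since [1/(k+1)^2 <= 2/((k+1)(k+2))], the increments are dominated by a telescoping sum, whose
    explicit value makes the induction close. *)
Lemma sum_inv_square_variation (A : R) (L : nat -> R) :
  0 <= A ->
  (forall k, Rabs (L (S k) - L k) <= A / (INR k + 1) ^ 2) ->
  forall n, Rabs (L n - L O) <= 2 * A * (1 - / (INR n + 1)).
Proof.
  intros HA H n. induction n as [|n IH].
  - rewrite Rminus_diag, Rabs_R0. simpl. lra.
  - rewrite S_INR. replace (L (S n) - L O) with ((L (S n) - L n) + (L n - L O)) by ring.
    apply Rle_trans with (1 := Rabs_triang _ _).
    apply Rle_trans with (A / (INR n + 1) ^ 2 + 2 * A * (1 - / (INR n + 1))).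
    { apply Rplus_le_compat; auto. }
    assert (Hn := pos_INR n).
    assert (H2 : 2 * A * (1 - / (INR n + 1 + 1)) - (A / (INR n + 1) ^ 2 + 2 * A * (1 - / (INR n + 1)))
      = A * INR n / ((INR n + 1) ^ 2 * (INR n + 2))) by (field; lra).
    assert (H3 : 0 <= A * INR n / ((INR n + 1) ^ 2 * (INR n + 2))); [|lra].
    apply Rmult_le_pos. now apply Rmult_le_pos.
    left; apply Rinv_0_lt_compat. apply Rmult_lt_0_compat; [apply pow_lt|]; lra.
Qed.

Lemma ln_1p_bounds (y : R) : 0 < 1 + y -> y - y ^ 2 / (1 + y) <= ln (1 + y) <= y.
Proof.
  intros Hy. split.
  - assert (H := ln_le_sub1 (/ (1 + y)) ltac:(now apply Rinv_0_lt_compat)).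
    rewrite ln_Rinv in H by trivial.
    replace (y - y ^ 2 / (1 + y)) with (1 - / (1 + y)) by (field; lra). lra.
  - generalize (ln_le_sub1 (1 + y) Hy); lra.
Qed.

(** The logarithm of [g k / (k+1)^z] changes by [ln (1 + z/(k+1/2)) - z ln (1 + 1/(k+1))] at each
    step. The first-order terms cancel up to [O(1/(k+1)^2)], which is summable, so that logarithm
    stays bounded. *)
Lemma product_power_growth (z : R) (g : nat -> R) :
  -1/2 < z -> 0 < g O ->
  (forall k, g (S k) = g k * (1 + z / (INR k + 1/2))) ->
  exists C, 0 < C /\ forall k,
    g k <= C * Rpower (INR k + 1) z /\ Rpower (INR k + 1) z <= C * g k.
Proof.
  intros Hz H0 Hg.
  assert (Hfac : forall k, 0 < 1 + z / (INR k + 1/2)).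
  { intros k. assert (Hk := pos_INR k).
    replace (1 + z / (INR k + 1/2)) with ((INR k + 1/2 + z) / (INR k + 1/2)) by (field; lra).
    apply Rdiv_lt_0_compat; lra. }
  assert (Hpos : forall k, 0 < g k).
  { induction k; trivial. rewrite Hg. now apply Rmult_lt_0_compat. }
  (* With this [c], [k + 1/2 + z >= c (k + 1)] for all [k >= 0]; it keeps the second-order error
     under control when [z] is close to [-1/2]. *)
  set (c := Rmin 1 (1/2 + z)).
  assert (Hc : 0 < c <= 1 /\ c <= 1/2 + z).
  { unfold c. assert (H1 := Rmin_l 1 (1/2 + z)). assert (H2 := Rmin_r 1 (1/2 + z)).
    assert (0 < Rmin 1 (1/2 + z)) by (apply Rmin_glb_lt; lra). lra. }
  set (A := 2 * Rabs z + 2 * z ^ 2 / c).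
  assert (HA : 0 <= A).
  { unfold A. assert (0 <= 2 * z ^ 2 / c).
    { apply Rmult_le_pos. generalize (pow2_ge_0 z); lra. left; apply Rinv_0_lt_compat; lra. }
    generalize (Rabs_pos z); lra. }
  set (L := fun k => ln (g k) - z * ln (INR k + 1)).
  assert (HL : forall k, Rabs (L (S k) - L k) <= A / (INR k + 1) ^ 2).
  { intros k. unfold L. rewrite Hg, ln_mult, S_INR by auto.
    assert (Hk := pos_INR k).
    replace (INR k + 1 + 1) with ((INR k + 1) * (1 + / (INR k + 1))) by (field; lra).
    assert (Hi : 0 < / (INR k + 1)) by (apply Rinv_0_lt_compat; lra).
    rewrite (ln_mult (INR k + 1)) by lra.
    destruct (ln_1p_bounds _ (Hfac k)) as [H1 H2].
    destruct (ln_1p_bounds (/ (INR k + 1)) ltac:(lra)) as [H3 H4].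
    set (l1 := ln (1 + z / (INR k + 1 / 2))) in *. set (l2 := ln (1 + / (INR k + 1))) in *.
    (* Three errors: the Taylor remainders of the two logarithms, and the difference
       [z/(k+1/2) - z/(k+1)] of their linear parts. They contribute the three pieces of [A]. *)
    replace (ln (g k) + l1 - z * (ln (INR k + 1) + l2) - (ln (g k) - z * ln (INR k + 1)))
      with ((l1 - z / (INR k + 1/2)) + z * (/ (INR k + 1) - l2) + z / 2 * (/ ((INR k + 1/2) * (INR k + 1))))
      by (field; lra).
    assert (Ha : Rabs (l1 - z / (INR k + 1/2)) <= 2 * z ^ 2 / c * / (INR k + 1) ^ 2).
    { apply Rle_trans with ((z / (INR k + 1/2)) ^ 2 / (1 + z / (INR k + 1/2))).
      - apply Rabs_le. lra.
      - replace ((z / (INR k + 1/2)) ^ 2 / (1 + z / (INR k + 1/2)))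
          with (z ^ 2 * / ((INR k + 1/2) * (INR k + 1/2 + z))) by (field; lra).
        replace (2 * z ^ 2 / c * / (INR k + 1) ^ 2)
          with (z ^ 2 * / ((INR k + 1) / 2 * (c * (INR k + 1)))) by (field; lra).
        apply Rmult_le_compat_l. apply pow2_ge_0. apply Rinv_le_contravar.
        + apply Rmult_lt_0_compat; [lra|apply Rmult_lt_0_compat; lra].
        + apply Rmult_le_compat; try lra; nra. }
    assert (Hb : Rabs (z * (/ (INR k + 1) - l2)) <= Rabs z * / (INR k + 1) ^ 2).
    { rewrite Rabs_mult. apply Rmult_le_compat_l. apply Rabs_pos.
      apply Rle_trans with ((/ (INR k + 1)) ^ 2 / (1 + / (INR k + 1))).
      - apply Rabs_le. lra.
      - replace ((/ (INR k + 1)) ^ 2 / (1 + / (INR k + 1))) with (/ ((INR k + 1) * (INR k + 2)))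
          by (field; lra).
        apply Rinv_le_contravar. apply pow_lt; lra. nra. }
    assert (Hd : Rabs (z / 2 * (/ ((INR k + 1/2) * (INR k + 1)))) <= Rabs z * / (INR k + 1) ^ 2).
    { rewrite Rabs_mult. unfold Rdiv. rewrite Rabs_mult, (Rabs_pos_eq (/ 2)) by lra.
      rewrite Rmult_assoc. apply Rmult_le_compat_l. apply Rabs_pos.
      rewrite Rabs_pos_eq by (left; apply Rinv_0_lt_compat; nra).
      rewrite <- Rinv_mult. apply Rinv_le_contravar. apply pow_lt; lra. nra. }
    apply Rle_trans with (1 := Rabs_triang _ _).
    apply Rle_trans with (2 * z ^ 2 / c * / (INR k + 1) ^ 2 + Rabs z * / (INR k + 1) ^ 2
       + Rabs z * / (INR k + 1) ^ 2).
    { apply Rplus_le_compat; trivial. apply Rle_trans with (1 := Rabs_triang _ _). lra. }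
    right. unfold A. field. lra. }
  assert (HB := sum_inv_square_variation A L HA HL).
  set (B := 2 * A + Rabs (ln (g O))).
  exists (exp B). split; [apply exp_pos|]. intros k.
  assert (HLk : Rabs (L k) <= B).
  { specialize (HB k).
    replace (L k) with (L k - L O + L O) by ring.
    apply Rle_trans with (1 := Rabs_triang _ _). unfold B.
    assert (HL0 : L O = ln (g O)). { unfold L. simpl. rewrite Rplus_0_l, ln_1. ring. }
    rewrite HL0 at 2.
    assert (0 < / (INR k + 1)) by (apply Rinv_0_lt_compat; generalize (pos_INR k); lra).
    nra. }
  unfold L in HLk. apply Rabs_le_between in HLk.
  unfold Rpower. rewrite <- (exp_ln (g k)) by auto. rewrite <- !exp_plus.
  split; apply exp_le; lra.
Qed.

Definition bessel_denom (zeta : R) (k : nat) : R :=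
  INR (Factorial.fact k) * Gamma (INR k + (zeta - 1/2) + 1).

Lemma bessel_denom_pos (zeta : R) (k : nat) : -1/2 < zeta -> 0 < bessel_denom zeta k.
Proof.
  intros Hz. apply Rmult_lt_0_compat. apply INR_fact_lt_0.
  apply Gamma_pos. generalize (pos_INR k); lra.
Qed.

Lemma bessel_denom_S (zeta : R) (k : nat) : -1/2 < zeta ->
  bessel_denom zeta (S k) = bessel_denom zeta k * ((INR k + 1) * (INR k + 1/2 + zeta)).
Proof.
  intros Hz. unfold bessel_denom.
  replace (INR (S k) + (zeta - 1/2) + 1) with (INR k + (zeta - 1/2) + 1 + 1) by (rewrite S_INR; ring).
  rewrite Gamma_succ by (generalize (pos_INR k); lra).
  rewrite fact_simpl, mult_INR, S_INR. field.
Qed.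

Lemma bessel_denom_bounds (zeta : R) : -1/2 < zeta ->
  exists C, 0 < C /\ forall k,
    bessel_denom zeta k * 4 ^ k <= C * Rpower (INR k + 1) zeta * INR (Factorial.fact (2 * k)) /\
    Rpower (INR k + 1) zeta * INR (Factorial.fact (2 * k)) <= C * (bessel_denom zeta k * 4 ^ k).
Proof.
  intros Hz.
  destruct (product_power_growth zeta
    (fun k => bessel_denom zeta k * 4 ^ k / INR (Factorial.fact (2 * k)))) as [C [HC H]]; trivial.
  - simpl. generalize (bessel_denom_pos zeta 0 Hz). lra.
  - intros k. rewrite bessel_denom_S by trivial.
    replace (2 * S k)%nat with (S (S (2 * k))) by lia.
    rewrite (fact_simpl (S (2 * k))), (fact_simpl (2 * k)), !mult_INR, !S_INR, mult_INR.
    change (INR 2) with 2. simpl pow.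
    assert (Hk := pos_INR k). assert (Hf := INR_fact_lt_0 (2 * k)).
    field. repeat split; lra.
  - exists C. split; trivial. intros k. destruct (H k) as [H1 H2].
    assert (Hf := INR_fact_lt_0 (2 * k)). split.
    + now apply (proj1 (Rle_div_l _ _ _ Hf)) in H1.
    + apply (Rmult_le_compat_r _ _ _ (Rlt_le _ _ Hf)) in H2.
      replace (C * (bessel_denom zeta k * 4 ^ k))
       with (C * (bessel_denom zeta k * 4 ^ k / INR (Factorial.fact (2 * k))) * INR (Factorial.fact (2 * k)))
       by (field; lra). exact H2.
Qed.

(** * Two-sided bounds for the Bessel function *)

Lemma is_series_le (a b : nat -> R) (la lb : R) :
  is_series a la -> is_series b lb -> (forall n, a n <= b n) -> la <= lb.
Proof.
  intros Ha Hb H.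
  apply (is_lim_seq_le (sum_n a) (sum_n b) la lb); trivial.
  intros n. apply sum_n_m_le. exact H.
Qed.

Definition cosh_term (x : R) (k : nat) : R := x ^ (2 * k) / INR (Factorial.fact (2 * k)).

Lemma cosh_term_pos (x : R) (k : nat) : 0 <= cosh_term x k.
Proof.
  unfold cosh_term. rewrite pow_mult. apply Rmult_le_pos.
  - apply pow_le, pow2_ge_0.
  - left; apply Rinv_0_lt_compat, INR_fact_lt_0.
Qed.

(** In the half-sum of the series of [exp x] and [exp (- x)] the odd terms vanish, so the partial
    sums here are its partial sums along the even indices. *)
Lemma is_series_cosh (x : R) : is_series (cosh_term x) (cosh x).
Proof.
  set (e := fun n => / 2 * (x ^ n * / INR (Factorial.fact n)) + / 2 * ((- x) ^ n * / INR (Factorial.fact n))).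
  assert (He : is_series e (cosh x)).
  { replace (cosh x) with (/ 2 * exp x + / 2 * exp (- x)) by (unfold cosh; field).
    assert (H : forall y, is_series (fun n => / 2 * (y ^ n * / INR (Factorial.fact n))) (/ 2 * exp y)).
    { intros y. apply (is_series_scal_l (/ 2) (fun n => y ^ n * / INR (Factorial.fact n))).
      apply (is_series_ext (fun k => scal (pow_n y k) (/ INR (Factorial.fact k)))).
      - intros n. now rewrite pow_n_pow.
      - apply is_exp_Reals. }
    apply (is_series_plus (fun n => / 2 * (x ^ n * / INR (Factorial.fact n)))
             (fun n => / 2 * ((- x) ^ n * / INR (Factorial.fact n)))); apply H. }
  assert (Hs : forall N, sum_n (cosh_term x) N = sum_n e (2 * N)).
  { induction N as [|N IH].
    - rewrite !sum_O. unfold cosh_term, e. simpl. field.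
    - replace (2 * S N)%nat with (S (S (2 * N))) by lia.
      rewrite !sum_Sn, IH.
      assert (H1 : e (S (2 * N)) = 0).
      { unfold e.
        replace ((- x) ^ S (2 * N)) with (- (x ^ S (2 * N))).
        - ring.
        - rewrite <- !tech_pow_Rmult, !pow_mult.
          replace ((- x) ^ 2) with (x ^ 2) by ring. ring. }
      assert (H2 : e (S (S (2 * N))) = cosh_term x (S N)).
      { unfold e, cosh_term. replace (2 * S N)%nat with (S (S (2 * N))) by lia.
        replace ((- x) ^ S (S (2 * N))) with (x ^ S (S (2 * N))).
        - field. apply INR_fact_neq_0.
        - rewrite <- !tech_pow_Rmult, !pow_mult.
          replace ((- x) ^ 2) with (x ^ 2) by ring. ring. }
      rewrite H1, H2. unfold plus; simpl. ring. }
  change (is_lim_seq (sum_n (cosh_term x)) (cosh x)).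
  apply (is_lim_seq_ext (fun N => sum_n e (2 * N))).
  - intros N. now rewrite Hs.
  - apply (is_lim_seq_subseq (sum_n e) (cosh x) (fun N => (2 * N)%nat)); trivial.
    apply eventually_subseq. intros; lia.
Qed.

Lemma cosh_bounds (x : R) : 0 <= x -> exp x / 2 <= cosh x <= exp x.
Proof.
  intros Hx. unfold cosh.
  assert (H := exp_pos (- x)). assert (exp (- x) <= exp x) by (apply exp_le; lra). lra.
Qed.

(* [cosh (x + x/(1+x))] dominates the mean of [(k+1)/(1+x)] by Bernoulli's inequality. *)
Lemma cosh_term_linear_moment (x : R) (k : nat) : 0 < x ->
  cosh_term x k * ((INR k + 1) / (1 + x)) <= cosh_term (x * (1 + / (1 + x))) k.
Proof.
  intros Hx. unfold cosh_term.
  rewrite Rpow_mult_distr. unfold Rdiv.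
  set (f := / INR (Factorial.fact (2 * k))).
  assert (Hf : 0 < f) by (apply Rinv_0_lt_compat, INR_fact_lt_0).
  assert (Hp : 0 < x ^ (2 * k)) by now apply pow_lt.
  assert (Hi : 0 < / (1 + x) < 1).
  { split. apply Rinv_0_lt_compat; lra. rewrite <- Rinv_1. apply Rinv_lt_contravar; lra. }
  replace (x ^ (2 * k) * (1 + / (1 + x)) ^ (2 * k) * f)
    with (x ^ (2 * k) * f * (1 + / (1 + x)) ^ (2 * k)) by ring.
  apply Rmult_le_compat_l. left; now apply Rmult_lt_0_compat.
  apply Rle_trans with (1 + INR (2 * k) * / (1 + x)).
  - rewrite mult_INR. change (INR 2) with 2. generalize (pos_INR k). nra.
  - apply poly. lra.
Qed.

Lemma fact_add_le (n m : nat) :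
  INR (Factorial.fact (n + m)) <= INR (Factorial.fact n) * INR (n + m) ^ m.
Proof.
  induction m as [|m IH].
  - rewrite Nat.add_0_r. simpl. lra.
  - rewrite Nat.add_succ_r, fact_simpl, mult_INR.
    apply Rle_trans with (INR (S (n + m)) * (INR (Factorial.fact n) * INR (S (n + m)) ^ m)).
    + apply Rmult_le_compat_l. apply pos_INR. apply Rle_trans with (1 := IH).
      apply Rmult_le_compat_l. apply pos_INR. apply pow_incr. split. apply pos_INR.
      apply le_INR. lia.
    + right. rewrite <- tech_pow_Rmult. ring.
Qed.

(** Dividing by [(k+1)^(2q)] amounts to a shift of index by [q]: [(2k+2q)!/(2k)! <= (2k+2q)^(2q) <=
    ((2q+2)(k+1))^(2q)], while [(1+x)^(2q) <= 2^(2q) (1 + x^(2q))] supplies the missing power of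
    [x]. *)
Lemma cosh_term_negative_moment (q : nat) (x : R) (k : nat) : 0 < x ->
  cosh_term x k * / ((INR k + 1) / (1 + x)) ^ (2 * q) <=
  2 ^ (2 * q) * (cosh_term x k + (2 * INR q + 2) ^ (2 * q) * cosh_term x (q + k)).
Proof.
  intros Hx.
  assert (Hk := pos_INR k). assert (Hq := pos_INR q).
  assert (Hk1 : 0 < (INR k + 1) ^ (2 * q)) by (apply pow_lt; lra).
  assert (H1x : 0 < (1 + x) ^ (2 * q)) by (apply pow_lt; lra).
  assert (H0x : 0 < x ^ (2 * q)) by (apply pow_lt; lra).
  assert (H2x : 0 < 2 ^ (2 * q)) by (apply pow_lt; lra).
  assert (Hx1 : (1 + x) ^ (2 * q) <= 2 ^ (2 * q) * (1 + x ^ (2 * q))).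
  { destruct (Rle_dec x 1).
    - apply Rle_trans with (2 ^ (2 * q)). apply pow_incr; lra. nra.
    - apply Rle_trans with ((2 * x) ^ (2 * q)). apply pow_incr; lra.
      rewrite Rpow_mult_distr. nra. }
  unfold Rdiv. rewrite Rpow_mult_distr, Rinv_mult, pow_inv, Rinv_inv.
  assert (Hsh : x ^ (2 * q) * / (INR k + 1) ^ (2 * q) * cosh_term x k
    <= (2 * INR q + 2) ^ (2 * q) * cosh_term x (q + k)).
  { unfold cosh_term.
    replace (2 * (q + k))%nat with (2 * k + 2 * q)%nat by lia.
    rewrite pow_add.
    assert (Hf1 := INR_fact_lt_0 (2 * k)). assert (Hf2 := INR_fact_lt_0 (2 * k + 2 * q)).
    assert (Hxk : 0 < x ^ (2 * k)) by (apply pow_lt; lra).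
    replace (x ^ (2 * q) * / (INR k + 1) ^ (2 * q) * (x ^ (2 * k) / INR (Factorial.fact (2 * k))))
      with (x ^ (2 * q) * x ^ (2 * k) * / (INR (Factorial.fact (2 * k)) * (INR k + 1) ^ (2 * q)))
      by (field; lra).
    replace ((2 * INR q + 2) ^ (2 * q) * (x ^ (2 * k) * x ^ (2 * q) / INR (Factorial.fact (2 * k + 2 * q))))
      with (x ^ (2 * q) * x ^ (2 * k) * ((2 * INR q + 2) ^ (2 * q) / INR (Factorial.fact (2 * k + 2 * q))))
      by (field; lra).
    apply Rmult_le_compat_l. left; now apply Rmult_lt_0_compat.
    apply Rle_div_r; trivial.
    apply (Rmult_le_reg_l (INR (Factorial.fact (2 * k)) * (INR k + 1) ^ (2 * q))).
    now apply Rmult_lt_0_compat.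
    rewrite <- Rmult_assoc, Rinv_r, Rmult_1_l by (apply Rgt_not_eq; now apply Rmult_lt_0_compat).
    apply Rle_trans with (1 := fact_add_le _ _).
    rewrite Rmult_assoc. apply Rmult_le_compat_l. lra.
    rewrite <- Rpow_mult_distr. apply pow_incr. split. apply pos_INR.
    rewrite plus_INR, !mult_INR. change (INR 2) with 2. nra. }
  assert (Hi : 0 < / (INR k + 1) ^ (2 * q) <= 1).
  { split. now apply Rinv_0_lt_compat. rewrite <- Rinv_1. apply Rinv_le_contravar. lra.
    apply pow_R1_Rle. lra. }
  assert (Hc := cosh_term_pos x k).
  apply Rle_trans with (cosh_term x k * (/ (INR k + 1) ^ (2 * q) * (2 ^ (2 * q) * (1 + x ^ (2 * q))))).
  - apply Rmult_le_compat_l; trivial. apply Rmult_le_compat_l; lra.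
  - replace (cosh_term x k * (/ (INR k + 1) ^ (2 * q) * (2 ^ (2 * q) * (1 + x ^ (2 * q)))))
      with (2 ^ (2 * q) * (cosh_term x k * / (INR k + 1) ^ (2 * q)
             + x ^ (2 * q) * / (INR k + 1) ^ (2 * q) * cosh_term x k)) by ring.
    apply Rmult_le_compat_l. lra. nra.
Qed.

Lemma ex_series_cosh_shift (x : R) (q : nat) :
  0 <= x -> exists l, is_series (fun k => cosh_term x (q + k)) l /\ l <= exp x.
Proof.
  intros Hx. assert (Hex : ex_series (cosh_term x)) by (exists (cosh x); apply is_series_cosh).
  exists (Series (fun k => cosh_term x (q + k))). split.
  - apply Series_correct. now apply (ex_series_incr_n (cosh_term x) q).
  - apply Rle_trans with (cosh x); [|apply cosh_bounds; lra].
    destruct q as [|q].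
    + right. apply is_series_unique. apply is_series_cosh.
    + rewrite <- (is_series_unique _ _ (is_series_cosh x)).
      rewrite (Series_incr_n (cosh_term x) (S q)) by (trivial; lia).
      assert (0 <= sum_f_R0 (cosh_term x) (pred (S q))); [|lra].
      apply cond_pos_sum. intros; apply cosh_term_pos.
Qed.

(** For [u >= 1] the exponent satisfies [-z <= 1]; for [u < 1] it satisfies [-z >= -2q]. So one of
    the two controllable moments dominates. *)
Lemma power_upper_envelope (z u : R) (q : nat) :
  -1 < z -> z <= 2 * INR q -> 0 < u -> Rpower u (- z) <= u + / u ^ (2 * q).
Proof.
  intros Hz Hq Hu.
  assert (Hp : 0 < u ^ (2 * q)) by now apply pow_lt.
  assert (Hi := Rinv_0_lt_compat _ Hp).
  destruct (Rle_dec 1 u) as [H|H].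
  - apply Rle_trans with u; [|lra]. rewrite <- (Rpower_1 u) at 2 by trivial.
    apply Rle_Rpower; lra.
  - apply Rle_trans with (/ u ^ (2 * q)); [|lra].
    rewrite <- Rpower_pow, <- Rpower_Ropp by trivial.
    rewrite <- (Rinv_inv u). rewrite !(Rpower_Rinv (/ u)) by now apply Rinv_0_lt_compat.
    apply Rle_Rpower.
    + rewrite <- Rinv_1. apply Rinv_le_contravar; lra.
    + rewrite mult_INR. change (INR 2) with 2. lra.
Qed.

(** The left side is at most 1 and becomes nonpositive outside [[1/C, C]]; inside, [u^(-z)] is at
    least [C^(-|z|)]. The form [2 * 1] matches the negative moment with [q = 1]. *)
Lemma power_lower_envelope (z u C : R) :
  1 <= C -> 0 < u ->
  1 - / u ^ (2 * 1) / C - u / C <= Rpower C (Rabs z) * Rpower u (- z).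
Proof.
  intros HC Hu. simpl Nat.mul.
  assert (Hp : 0 < u ^ 2) by now apply pow_lt.
  assert (Hi := Rinv_0_lt_compat _ Hp).
  assert (HCp := Rpower_pos C (Rabs z)). assert (Hup := Rpower_pos u (- z)).
  assert (0 < / u ^ 2 / C) by (apply Rdiv_lt_0_compat; lra).
  assert (0 < u / C) by (apply Rdiv_lt_0_compat; lra).
  destruct (Rle_dec u C) as [H1|H1]; [destruct (Rle_dec (/ u) C) as [H2|H2]|].
  - assert (H3 := Rpower_compare C 1 u (- z) Rlt_0_1 Hu).
    rewrite Rabs_Ropp in H3. unfold Rpower in H3 at 1. rewrite ln_1, Rmult_0_r, exp_0 in H3.
    assert (1 <= C * u).
    { apply (Rmult_le_compat_l u) in H2; [|lra]. rewrite Rinv_r in H2; lra. }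
    lra.
  - assert (1 <= / u ^ 2 / C).
    { apply Rle_div_r; [lra|]. rewrite <- pow_inv. nra. }
    nra.
  - assert (1 <= u / C). { apply Rle_div_r; lra. } nra.
Qed.

Definition bessel_coef (zeta : R) (k : nat) : R := / bessel_denom zeta k.

Lemma weighted_cosh_upper (zeta : R) : -1 < zeta ->
  exists C, 0 < C /\ forall x, 0 < x ->
    exists l, is_series (fun k => cosh_term x k * Rpower ((INR k + 1) / (1 + x)) (- zeta)) l /\
      l <= C * exp x.
Proof.
  intros Hz. destruct (nfloor_ex (Rabs zeta) (Rabs_pos _)) as [n Hn].
  set (q := S n).
  assert (Hq : zeta <= 2 * INR q).
  { unfold q. rewrite S_INR. generalize (Rle_abs zeta) (pos_INR n). lra. }
  set (D := (2 * INR q + 2) ^ (2 * q)).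
  assert (HD : 0 < D) by (apply pow_lt; generalize (pos_INR q); lra).
  assert (H2 : 0 < 2 ^ (2 * q)) by (apply pow_lt; lra).
  exists (exp 1 + 2 ^ (2 * q) * (1 + D)). split.
  { apply Rplus_lt_0_compat. apply exp_pos. apply Rmult_lt_0_compat; lra. }
  intros x Hx.
  destruct (ex_series_cosh_shift x q ltac:(lra)) as [l1 [Hl1 Hl1']].
  (* The argument required by [cosh_term_linear_moment]; as [y <= x + 1], it costs only a factor
     [exp 1]. *)
  set (y := x * (1 + / (1 + x))).
  assert (Hy : 0 <= y <= x + 1).
  { assert (Hi : 0 < / (1 + x)) by (apply Rinv_0_lt_compat; lra).
    assert (x * / (1 + x) <= 1) by (apply (Rle_div_l x); lra).
    unfold y. split; nra. }
  set (b := fun k => cosh_term y k + 2 ^ (2 * q) * (cosh_term x k + D * cosh_term x (q + k))).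
  assert (Hb : is_series b (cosh y + 2 ^ (2 * q) * (cosh x + D * l1))).
  { apply (is_series_plus (cosh_term y)); [apply is_series_cosh|].
    apply (is_series_scal_l (2 ^ (2 * q)) (fun k => cosh_term x k + D * cosh_term x (q + k))).
    apply (is_series_plus (cosh_term x)); [apply is_series_cosh|].
    now apply (is_series_scal_l D (fun k => cosh_term x (q + k))). }
  set (a := fun k => cosh_term x k * Rpower ((INR k + 1) / (1 + x)) (- zeta)).
  assert (Hab : forall k, 0 <= a k <= b k).
  { intros k. unfold a, b. split.
    - apply Rmult_le_pos. apply cosh_term_pos. left; apply Rpower_pos.
    - assert (Hu : 0 < (INR k + 1) / (1 + x)) by (apply Rdiv_lt_0_compat; generalize (pos_INR k); lra).
      apply Rle_trans with (cosh_term x k * ((INR k + 1) / (1 + x) + / ((INR k + 1) / (1 + x)) ^ (2 * q))).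
      + apply Rmult_le_compat_l. apply cosh_term_pos. now apply power_upper_envelope.
      + rewrite Rmult_plus_distr_l. apply Rplus_le_compat.
        * now apply cosh_term_linear_moment.
        * now apply cosh_term_negative_moment. }
  assert (Hexa : ex_series a).
  { apply (ex_series_le a b).
    - intros k. destruct (Hab k). unfold norm; simpl. unfold abs; simpl. rewrite Rabs_pos_eq; lra.
    - eexists; exact Hb. }
  exists (Series a). split. now apply Series_correct.
  apply Rle_trans with (cosh y + 2 ^ (2 * q) * (cosh x + D * l1)).
  - rewrite <- (is_series_unique _ _ Hb). apply Series_le; trivial. eexists; exact Hb.
  - assert (Hcy := proj2 (cosh_bounds y ltac:(lra))).
    assert (Hcx := proj2 (cosh_bounds x ltac:(lra))).
    assert (exp y <= exp 1 * exp x) by (rewrite <- exp_plus; apply exp_le; lra).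
    rewrite Rmult_plus_distr_r. apply Rplus_le_compat; [lra|].
    rewrite Rmult_assoc. apply Rmult_le_compat_l; [lra|]. nra.
Qed.

Lemma weighted_cosh_lower (zeta : R) :
  exists c, 0 < c /\ forall x l, 0 < x ->
    is_series (fun k => cosh_term x k * Rpower ((INR k + 1) / (1 + x)) (- zeta)) l ->
    c * exp x <= l.
Proof.
  set (D := (2 * INR 1 + 2) ^ (2 * 1)).
  (* The two subtracted moments sum to at most [(C/8) exp x]. After division by [C] they remove at
     most [exp x / 8] from [cosh x >= exp x / 2], leaving more than [exp x / 4]. *)
  set (C := 8 * exp 1 + 8 * (2 ^ (2 * 1) * (1 + D))).
  assert (HD : D = 16) by (unfold D; simpl; ring).
  assert (He := exp_pos 1).
  assert (HC : 8 <= C) by (unfold C; rewrite HD; simpl; lra).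
  exists (/ Rpower C (Rabs zeta) / 4).
  assert (HP := Rpower_pos C (Rabs zeta)). assert (HPi := Rinv_0_lt_compat _ HP).
  split; [lra|].
  intros x l Hx Hl.
  destruct (ex_series_cosh_shift x 1 ltac:(lra)) as [l1 [Hl1 Hl1']].
  set (y := x * (1 + / (1 + x))).
  assert (Hy : 0 <= y <= x + 1).
  { assert (Hi : 0 < / (1 + x)) by (apply Rinv_0_lt_compat; lra).
    assert (x * / (1 + x) <= 1) by (apply (Rle_div_l x); lra).
    unfold y. split; nra. }
  set (b := fun k => cosh_term x k + (- / C) * (cosh_term y k +
      2 ^ (2 * 1) * (cosh_term x k + D * cosh_term x (1 + k)))).
  assert (Hb : is_series b (cosh x + (- / C) * (cosh y + 2 ^ (2 * 1) * (cosh x + D * l1)))).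
  { apply (is_series_plus (cosh_term x)); [apply is_series_cosh|].
    apply (is_series_scal_l (- / C) (fun k => cosh_term y k +
      2 ^ (2 * 1) * (cosh_term x k + D * cosh_term x (1 + k)))).
    apply (is_series_plus (cosh_term y)); [apply is_series_cosh|].
    apply (is_series_scal_l (2 ^ (2 * 1)) (fun k => cosh_term x k + D * cosh_term x (1 + k))).
    apply (is_series_plus (cosh_term x)); [apply is_series_cosh|].
    now apply (is_series_scal_l D (fun k => cosh_term x (1 + k))). }
  assert (Hle : cosh x + (- / C) * (cosh y + 2 ^ (2 * 1) * (cosh x + D * l1)) <= Rpower C (Rabs zeta) * l).
  { apply (is_series_le b (fun k => Rpower C (Rabs zeta) *
       (cosh_term x k * Rpower ((INR k + 1) / (1 + x)) (- zeta)))); trivial.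
    - apply (is_series_scal_l (Rpower C (Rabs zeta)) (fun k =>
       (cosh_term x k * Rpower ((INR k + 1) / (1 + x)) (- zeta)))). exact Hl.
    - intros k. unfold b.
      assert (Hu : 0 < (INR k + 1) / (1 + x)) by (apply Rdiv_lt_0_compat; generalize (pos_INR k); lra).
      set (u := (INR k + 1) / (1 + x)) in *.
      assert (HE := power_lower_envelope zeta u C ltac:(lra) Hu).
      assert (Hc := cosh_term_pos x k).
      assert (H1 := cosh_term_linear_moment x k Hx). fold u y in H1.
      assert (H2 := cosh_term_negative_moment 1 x k Hx). fold u D in H2.
      apply Rle_trans with (cosh_term x k * (1 - / u ^ (2 * 1) / C - u / C)).
      + assert (HCi : 0 < / C) by (apply Rinv_0_lt_compat; lra).
        unfold Rdiv. nra.
      + rewrite (Rmult_comm (Rpower C (Rabs zeta))), Rmult_assoc.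
        apply Rmult_le_compat_l; trivial. rewrite (Rmult_comm (Rpower u (- zeta))). exact HE. }
  assert (Hcy := proj2 (cosh_bounds y ltac:(lra))).
  assert (Hcx := cosh_bounds x ltac:(lra)).
  assert (Hey : exp y <= exp 1 * exp x) by (rewrite <- exp_plus; apply exp_le; lra).
  assert (Hbd : cosh y + 2 ^ (2 * 1) * (cosh x + D * l1) <= C * (exp x / 8)).
  { unfold C. rewrite HD in *. simpl in *. lra. }
  assert (Hbd2 : / C * (cosh y + 2 ^ (2 * 1) * (cosh x + D * l1)) <= exp x / 8).
  { apply (Rmult_le_reg_l C); [lra|]. rewrite <- Rmult_assoc, Rinv_r by lra. lra. }
  assert (Hex := exp_pos x).
  apply (Rmult_le_reg_l (Rpower C (Rabs zeta))); trivial.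
  replace (Rpower C (Rabs zeta) * (/ Rpower C (Rabs zeta) / 4 * exp x)) with (exp x / 4) by (field; lra).
  lra.
Qed.

(** Splitting off [(x/2)^nu] leaves a power series in [(x/2)^2]. The library theory of power series
    then gives continuity, and the coefficients can be compared term by term. *)
Lemma BesselI_PSeries (zeta x : R) : 0 < x ->
  BesselI (zeta - 1/2) x =
  Rpower (x / 2) (zeta - 1/2) * PSeries (bessel_coef zeta) ((x / 2) ^ 2).
Proof.
  intros Hx. unfold BesselI, PSeries. rewrite <- Series_scal_l. apply Series_ext. intros k.
  unfold bessel_coef, bessel_denom. rewrite Rpower_plus.
  replace (Rpower (x / 2) (2 * INR k)) with (((x / 2) ^ 2) ^ k).
  - unfold Rdiv. ring.
  - rewrite <- pow_mult, <- Rpower_pow by lra. f_equal. now rewrite mult_INR.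
Qed.

Lemma bessel_series_bounds (zeta : R) : -1/2 < zeta ->
  exists C, 0 < C /\ forall x, 0 < x ->
    PSeries (bessel_coef zeta) ((x / 2) ^ 2) <= C * (Rpower (1 + x) (- zeta) * exp x) /\
    Rpower (1 + x) (- zeta) * exp x <= C * PSeries (bessel_coef zeta) ((x / 2) ^ 2).
Proof.
  intros Hz.
  destruct (bessel_denom_bounds zeta Hz) as [C0 [HC0 HB]].
  destruct (weighted_cosh_upper zeta ltac:(lra)) as [C1 [HC1 HU]].
  destruct (weighted_cosh_lower zeta) as [c2 [Hc2 HL]].
  assert (Hc2i := Rinv_0_lt_compat _ Hc2).
  exists (C0 * C1 + C0 / c2). split.
  { apply Rplus_lt_0_compat; now apply Rmult_lt_0_compat. }
  intros x Hx.
  destruct (HU x Hx) as [l [Hl Hl']].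
  assert (HLl := HL x l Hx Hl).
  set (w := fun k => cosh_term x k * Rpower ((INR k + 1) / (1 + x)) (- zeta)) in *.
  set (b := fun k => bessel_coef zeta k * ((x / 2) ^ 2) ^ k).
  set (P := Rpower (1 + x) (- zeta)). assert (HP : 0 < P) by apply Rpower_pos.
  assert (Hk : forall k, 0 <= b k /\ b k <= C0 * P * w k /\ P * w k <= C0 * b k).
  { intros k.
    assert (Hd := bessel_denom_pos zeta k Hz). assert (H4 : 0 < 4 ^ k) by (apply pow_lt; lra).
    assert (Hf := INR_fact_lt_0 (2 * k)). assert (Hxk : 0 < x ^ (2 * k)) by now apply pow_lt.
    assert (Hpk := Rpower_pos (INR k + 1) zeta). assert (Hk0 := pos_INR k).
    assert (Hb : b k = x ^ (2 * k) * / (bessel_denom zeta k * 4 ^ k)).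
    { unfold b, bessel_coef. replace ((x / 2) ^ 2) with (x ^ 2 * / 4) by field.
      rewrite Rpow_mult_distr, <- pow_mult, pow_inv. field. lra. }
    (* The factor [(1+x)^zeta] hidden in the normalized weight cancels against [P]. What remains
       differs from [b k] only in the denominator, which [bessel_denom_bounds] controls. *)
    assert (Hw : P * w k = x ^ (2 * k) * / (Rpower (INR k + 1) zeta * INR (Factorial.fact (2 * k)))).
    { unfold P, w, cosh_term. rewrite Rpower_Rdiv by lra. rewrite (Rpower_Ropp (INR k + 1)).
      field. repeat split; try lra. apply Rgt_not_eq, Rpower_pos. }
    destruct (HB k) as [H1 H2].
    assert (Hdp : 0 < bessel_denom zeta k * 4 ^ k) by now apply Rmult_lt_0_compat.
    assert (Hrp : 0 < Rpower (INR k + 1) zeta * INR (Factorial.fact (2 * k))) by now apply Rmult_lt_0_compat.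
    rewrite Rmult_assoc, Hw, Hb.
    set (d := bessel_denom zeta k * 4 ^ k) in *. rewrite Rmult_assoc in H1.
    set (e := Rpower (INR k + 1) zeta * INR (Factorial.fact (2 * k))) in *.
    assert (Hinv : forall u v, 0 < u -> 0 < v -> u <= C0 * v -> / v <= C0 * / u).
    { intros u v Hu Hv Huv. apply (Rmult_le_reg_l u); trivial. apply (Rmult_le_reg_r v); trivial.
      replace (u * / v * v) with u by (field; lra).
      replace (u * (C0 * / u) * v) with (C0 * v) by (field; lra). trivial. }
    assert (I1 := Hinv _ _ Hdp Hrp H1). assert (I2 := Hinv _ _ Hrp Hdp H2).
    repeat split.
    - left; apply Rmult_lt_0_compat; trivial. now apply Rinv_0_lt_compat.
    - nra.
    - nra. }
  assert (Hw : is_series (fun k => C0 * P * w k) (C0 * P * l)) by (now apply (is_series_scal_l (C0 * P) w)).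
  assert (Hexb : ex_series b).
  { apply (ex_series_le b (fun k => C0 * P * w k)).
    - intros k. destruct (Hk k) as [H1 [H2 _]]. unfold norm; simpl. unfold abs; simpl.
      rewrite Rabs_pos_eq; lra.
    - eexists; exact Hw. }
  change (PSeries (bessel_coef zeta) ((x / 2) ^ 2)) with (Series b).
  assert (Hb := Series_correct _ Hexb).
  assert (L1 : Series b <= C0 * P * l).
  { apply (is_series_le b (fun k => C0 * P * w k)); trivial. apply Hk. }
  assert (L2 : P * l <= C0 * Series b).
  { apply (is_series_le (fun k => P * w k) (fun k => C0 * b k)).
    - now apply (is_series_scal_l P w).
    - now apply (is_series_scal_l C0 b).
    - apply Hk. }
  assert (He := exp_pos x).
  assert (HS : 0 <= Series b).
  { apply (Rmult_le_reg_l C0); trivial. rewrite Rmult_0_r. apply Rle_trans with (2 := L2).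
    apply Rmult_le_pos; [lra|]. apply Rle_trans with (2 := HLl). apply Rmult_le_pos; lra. }
  split.
  - apply Rle_trans with (1 := L1).
    apply Rle_trans with (C0 * P * (C1 * exp x)).
    + apply Rmult_le_compat_l; [|lra]. left; now apply Rmult_lt_0_compat.
    + assert (0 < C0 / c2 * (P * exp x)).
      { repeat apply Rmult_lt_0_compat; trivial. }
      nra.
  - apply Rle_trans with (/ c2 * (P * l)).
    + apply (Rmult_le_reg_l c2); trivial.
      replace (c2 * (/ c2 * (P * l))) with (P * l) by (field; lra). nra.
    + apply Rle_trans with (/ c2 * (C0 * Series b)). apply Rmult_le_compat_l; lra.
      unfold Rdiv. assert (0 <= C0 * C1 * Series b); [|lra].
      apply Rmult_le_pos; trivial. left; now apply Rmult_lt_0_compat.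
Qed.

Lemma CV_radius_bessel_coef (zeta : R) : -1/2 < zeta -> CV_radius (bessel_coef zeta) = p_infty.
Proof.
  intros Hz. apply CV_radius_infinite_DAlembert.
  - intros n. apply Rinv_neq_0_compat, Rgt_not_eq, bessel_denom_pos, Hz.
  - apply (is_lim_seq_le_le (fun _ => 0) _ (fun n => / (1/2 + zeta) * / INR (S n))).
    + intros n. split. apply Rabs_pos.
      assert (Hd := bessel_denom_pos zeta n Hz). assert (Hn := pos_INR n).
      assert (Hi : 0 < (INR n + 1) * (INR n + 1/2 + zeta)) by (apply Rmult_lt_0_compat; lra).
      unfold bessel_coef. rewrite bessel_denom_S by trivial.
      replace (/ (bessel_denom zeta n * ((INR n + 1) * (INR n + 1 / 2 + zeta))) / / bessel_denom zeta n)
        with (/ ((INR n + 1) * (INR n + 1/2 + zeta))) by (field; lra).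
      rewrite Rabs_pos_eq by (left; now apply Rinv_0_lt_compat).
      rewrite S_INR, <- Rinv_mult. apply Rinv_le_contravar. apply Rmult_lt_0_compat; lra. nra.
    + apply is_lim_seq_const.
    + replace (Finite 0) with (Rbar_mult (/ (1/2 + zeta)) 0) by (simpl; now rewrite Rmult_0_r).
      apply is_lim_seq_scal_l.
      apply (is_lim_seq_incr_1 (fun n => / INR n)).
      replace (Finite 0) with (Rbar_inv p_infty) by reflexivity.
      apply is_lim_seq_inv. apply is_lim_seq_INR. discriminate.
Qed.

(** Needed to integrate [p2] against the stable density, which is only Riemann integrable on compact
    intervals. *)
Lemma p2_continuous (zeta r s t : R) : -1/2 < zeta -> 0 < r -> 0 < s -> 0 < t ->
  continuous (fun tau => p2 zeta tau r s) t.
Proof.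
  intros Hz Hr Hs Ht. assert (Hrs : 0 < r * s) by now apply Rmult_lt_0_compat.
  apply (continuous_ext_loc _ (fun tau =>
    Rpower (r * s) (1/2 - zeta) / (2 * tau) * exp (- (r ^ 2 + s ^ 2) / (4 * tau))
    * Rpower (r * s / (2 * tau) / 2) (zeta - 1/2) *
    PSeries (bessel_coef zeta) ((r * s / (2 * tau) / 2) ^ 2))).
  - exists (mkposreal t Ht). intros y Hy.
    assert (Hy0 : 0 < y). { apply Rabs_def2 in Hy. simpl in Hy. unfold minus, plus, opp in Hy; simpl in Hy. lra. }
    unfold p2. rewrite BesselI_PSeries by (apply Rdiv_lt_0_compat; lra).
    apply Rmult_assoc.
  - apply (continuous_mult (K := R_AbsRing) (fun tau =>
    Rpower (r * s) (1/2 - zeta) / (2 * tau) * exp (- (r ^ 2 + s ^ 2) / (4 * tau))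
    * Rpower (r * s / (2 * tau) / 2) (zeta - 1/2))
      (fun tau => PSeries (bessel_coef zeta) ((r * s / (2 * tau) / 2) ^ 2))).
    + apply (ex_derive_continuous (fun tau =>
    Rpower (r * s) (1/2 - zeta) / (2 * tau) * exp (- (r ^ 2 + s ^ 2) / (4 * tau))
    * Rpower (r * s / (2 * tau) / 2) (zeta - 1/2))).
      unfold Rpower. auto_derive. repeat split; try lra.
      apply Rmult_lt_0_compat; [|lra]. apply Rdiv_lt_0_compat; lra.
    + apply (continuous_comp (fun tau => (r * s / (2 * tau) / 2) ^ 2) (PSeries (bessel_coef zeta))).
      * apply (ex_derive_continuous (fun tau => (r * s / (2 * tau) / 2) ^ 2)). auto_derive. lra.
      * apply continuity_pt_filterlim. apply PSeries_continuity.
        now rewrite CV_radius_bessel_coef.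
Qed.

(** * Gaussian bounds for the Bessel heat kernel *)

Definition gauss_kernel (zeta t r s : R) : R :=
  Rpower t (- (1/2)) * exp (- ((r - s) ^ 2 / (4 * t))) / Rpower (r * s + t) zeta.

Lemma gauss_kernel_pos (zeta t r s : R) : 0 < gauss_kernel zeta t r s.
Proof.
  unfold gauss_kernel. apply Rdiv_lt_0_compat; [apply Rmult_lt_0_compat|]; apply exp_pos.
Qed.

(** At [x = rs/(2t)] the growth [e^x] completes the square in the exponential, the powers of [rs]
    cancel, and [(1+x)^(-zeta)] becomes a multiple of [t^zeta (rs+2t)^(-zeta)]. *)
Lemma p2_gauss_bounds (zeta : R) : -1/2 < zeta ->
  exists C, 0 < C /\ forall r s t, 0 < r -> 0 < s -> 0 < t ->
    p2 zeta t r s <= C * gauss_kernel zeta t r s /\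
    gauss_kernel zeta t r s <= C * p2 zeta t r s.
Proof.
  intros Hz. destruct (bessel_series_bounds zeta Hz) as [C [HC HB]].
  set (A := Rpower 2 (Rabs zeta)). assert (HA : 1 <= A) by (apply Rpower_ge1; [lra|apply Rabs_pos]).
  (* All the powers of two left over from [2t], [x/2] and [1 + x]. *)
  set (E := Rpower 2 (- (1/2)) * Rpower 2 (1/2 - zeta)).
  assert (HE : 0 < E) by (apply Rmult_lt_0_compat; apply Rpower_pos).
  assert (HEi := Rinv_0_lt_compat _ HE).
  exists (C * A * (E + / E)). split.
  { repeat apply Rmult_lt_0_compat; lra. }
  intros r s t Hr Hs Ht.
  assert (Hrs : 0 < r * s) by now apply Rmult_lt_0_compat.
  set (x := r * s / (2 * t)). assert (Hx : 0 < x) by (apply Rdiv_lt_0_compat; lra).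
  destruct (HB x Hx) as [H1 H2].
  set (PS := PSeries (bessel_coef zeta) ((x / 2) ^ 2)) in *.
  set (F := Rpower (r * s) (1/2 - zeta) / (2 * t) * exp (- (r ^ 2 + s ^ 2) / (4 * t))
      * Rpower (x / 2) (zeta - 1/2)).
  assert (HF : 0 < F).
  { unfold F. apply Rmult_lt_0_compat; [|apply Rpower_pos]. apply Rmult_lt_0_compat; [|apply exp_pos].
    apply Rdiv_lt_0_compat. apply Rpower_pos. lra. }
  assert (Hp : p2 zeta t r s = F * PS).
  { unfold p2. fold x. rewrite BesselI_PSeries by trivial. fold PS. unfold F, Rdiv. ring. }
  set (G := E * (Rpower t (- (1/2)) * exp (- ((r - s) ^ 2 / (4 * t))) / Rpower (r * s + 2 * t) zeta)).
  assert (HFG : F * (Rpower (1 + x) (- zeta) * exp x) = G).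
  { unfold F, G.
    assert (Hl1 : ln (x / 2) = ln (r * s) - 2 * ln 2 - ln t).
    { unfold x. rewrite !ln_div, (ln_mult 2 t); try lra; apply Rdiv_lt_0_compat; lra. }
    assert (Hl2 : ln (1 + x) = ln (r * s + 2 * t) - ln 2 - ln t).
    { unfold x. replace (1 + r * s / (2 * t)) with ((r * s + 2 * t) / (2 * t)) by (field; lra).
      rewrite ln_div, (ln_mult 2 t); lra. }
    replace (2 * t) with (exp (ln 2 + ln t)) at 1 by (rewrite exp_plus, !exp_ln; lra).
    unfold E, Rpower. rewrite Hl1, Hl2. unfold Rdiv. rewrite <- !exp_Ropp.
    rewrite <- !exp_plus. f_equal. unfold x. field. lra. }
  assert (Hg : gauss_kernel zeta t r s = Rpower t (- (1/2)) * exp (- ((r - s) ^ 2 / (4 * t))) * / Rpower (r * s + t) zeta)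
    by reflexivity.
  set (Q := Rpower t (- (1/2)) * exp (- ((r - s) ^ 2 / (4 * t)))) in *.
  assert (HQ : 0 < Q) by (apply Rmult_lt_0_compat; apply exp_pos).
  assert (HG1 : G <= E * A * gauss_kernel zeta t r s).
  { rewrite Hg. unfold G, Rdiv. rewrite <- !Rpower_Ropp.
    assert (H := Rpower_compare 2 (r * s + 2 * t) (r * s + t) (- zeta) ltac:(lra) ltac:(lra) ltac:(lra) ltac:(lra)).
    rewrite Rabs_Ropp in H. fold A in H.
    replace (E * A * (Q * Rpower (r * s + t) (- zeta))) with (E * (Q * (A * Rpower (r * s + t) (- zeta)))) by ring.
    apply Rmult_le_compat_l; [lra|]. apply Rmult_le_compat_l; lra. }
  assert (HG2 : gauss_kernel zeta t r s <= / E * A * G).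
  { rewrite Hg. unfold G, Rdiv. rewrite <- !Rpower_Ropp.
    assert (H := Rpower_compare 2 (r * s + t) (r * s + 2 * t) (- zeta) ltac:(lra) ltac:(lra) ltac:(lra) ltac:(lra)).
    rewrite Rabs_Ropp in H. fold A in H.
    replace (/ E * A * (E * (Q * Rpower (r * s + 2 * t) (- zeta)))) with (Q * (A * Rpower (r * s + 2 * t) (- zeta))) by (field; lra).
    apply Rmult_le_compat_l; lra. }
  rewrite Hp. assert (Hgp := gauss_kernel_pos zeta t r s).
  set (g := gauss_kernel zeta t r s) in *.
  assert (K1 : F * PS <= C * G).
  { rewrite <- HFG. replace (C * (F * (Rpower (1 + x) (- zeta) * exp x))) with
      (F * (C * (Rpower (1 + x) (- zeta) * exp x))) by ring. apply Rmult_le_compat_l; lra. }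
  assert (K2 : G <= C * (F * PS)).
  { rewrite <- HFG. replace (C * (F * PS)) with (F * (C * PS)) by ring. apply Rmult_le_compat_l; lra. }
  assert (HPS : 0 < F * PS).
  { assert (0 < G). { rewrite <- HFG. apply Rmult_lt_0_compat; trivial. apply Rmult_lt_0_compat; apply exp_pos. }
    apply (Rmult_lt_reg_l C); lra. }
  assert (HCA : 0 < C * A) by (apply Rmult_lt_0_compat; lra).
  split.
  - apply Rle_trans with (1 := K1).
    apply Rle_trans with (C * (E * A * g)). apply Rmult_le_compat_l; lra.
    replace (C * (E * A * g)) with (C * A * g * E) by ring.
    replace (C * A * (E + / E) * g) with (C * A * g * (E + / E)) by ring.
    apply Rmult_le_compat_l; [|lra]. left; now apply Rmult_lt_0_compat.
  - apply Rle_trans with (1 := HG2).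
    apply Rle_trans with (/ E * A * (C * (F * PS))).
    + apply Rmult_le_compat_l; trivial. apply Rmult_le_pos; lra.
    + replace (/ E * A * (C * (F * PS))) with (C * A * (F * PS) * / E) by ring.
      replace (C * A * (E + / E) * (F * PS)) with (C * A * (F * PS) * (E + / E)) by ring.
      apply Rmult_le_compat_l; [|lra]. left; now apply Rmult_lt_0_compat.
Qed.

(** Scaling reduces to [w = 1], with [a], [b] in place of [r], [s]. The factor [1 + d] is lost when
    one variable is below 1 and the other above: if [b < 1 <= a], then [m = b] and
    [a <= b + d < 1 + d]. *)
Lemma truncated_product_bounds (r s w : R) : 0 < r -> 0 < s -> 0 < w ->
  let d := Rabs (r - s) / w in
  let m := Rmin 1 (r / w) * Rmin 1 (s / w) in
  m * (r * s + w * w) <= 2 * (r * s) /\ r * s <= (1 + d) * (m * (r * s + w * w)).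
Proof.
  intros Hr Hs Hw d m.
  assert (Hd : 0 <= d) by (apply Rmult_le_pos; [apply Rabs_pos|left; now apply Rinv_0_lt_compat]).
  assert (Hdw : d * w = Rabs (r - s)) by (unfold d; field; lra).
  assert (Hrs : 0 < r * s) by now apply Rmult_lt_0_compat.
  assert (Hww : 0 < w * w) by now apply Rmult_lt_0_compat.
  set (a := r / w) in *. set (b := s / w) in *.
  assert (Ha : r = a * w) by (unfold a; field; lra).
  assert (Hb : s = b * w) by (unfold b; field; lra).
  assert (Ha0 : 0 < a) by now apply Rdiv_lt_0_compat.
  assert (Hb0 : 0 < b) by now apply Rdiv_lt_0_compat.
  assert (Hdab : d = Rabs (a - b)).
  { apply (Rmult_eq_reg_r w); [|lra]. rewrite Hdw, Ha, Hb, <- Rmult_minus_distr_r, Rabs_mult.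
    rewrite (Rabs_pos_eq w); lra. }
  replace (r * s) with (a * b * (w * w)) by (rewrite Ha, Hb; ring).
  replace (m * (a * b * (w * w) + w * w)) with (m * (a * b + 1) * (w * w)) by ring.
  assert (Hab : 0 < a * b) by now apply Rmult_lt_0_compat.
  assert (K : m * (a * b + 1) <= 2 * (a * b) /\ a * b <= (1 + d) * (m * (a * b + 1))).
  { clearbody d a b. subst m.
    assert (Hda : a - b <= d) by (rewrite Hdab; apply Rle_abs).
    assert (Hdb : b - a <= d) by (rewrite Hdab, Rabs_minus_sym; apply Rle_abs).
    unfold Rmin. destruct (Rle_dec 1 a); destruct (Rle_dec 1 b).
    - assert (1 <= a * b) by nra. split; nra.
    - assert (a * b * b <= a * b * 1) by (apply Rmult_le_compat_l; lra).
      assert (b <= a * b) by nra. split; [lra|].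
      assert (HH : a <= (1 + d) * (a * b + 1)) by nra.
      apply (Rmult_le_compat_r b) in HH; lra.
    - assert (a * b * a <= a * b * 1) by (apply Rmult_le_compat_l; lra).
      assert (a <= a * b) by nra. split; [lra|].
      assert (HH : b <= (1 + d) * (a * b + 1)) by nra.
      apply (Rmult_le_compat_r a) in HH; lra.
    - assert (a * b <= 1) by nra. split; [nra|].
      assert (HH : 1 <= (1 + d) * (a * b + 1)) by nra.
      apply (Rmult_le_compat_r (a * b)) in HH; lra. }
  destruct K as [K1 K2]. split.
  - rewrite <- (Rmult_assoc 2). apply Rmult_le_compat_r; lra.
  - rewrite <- (Rmult_assoc (1 + d)). apply Rmult_le_compat_r; lra.
Qed.

(** [M ln (1+d) <= M d <= 2 M^2 + d^2/8], the last step being [(4M - d)^2 >= 0]. A Gaussian half as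
    strong in the exponent as the one in [gauss_kernel] thus absorbs the polynomial loss. *)
Lemma Rpower_2_1p_le_gauss (M d : R) : 0 <= M -> 0 <= d ->
  Rpower (2 * (1 + d)) M <= exp (M * ln 2 + 2 * M ^ 2) * exp (d ^ 2 / 8).
Proof.
  intros HM Hd. unfold Rpower. rewrite <- exp_plus. apply exp_le.
  rewrite ln_mult by lra. assert (H := ln_le_sub1 (1 + d) ltac:(lra)).
  assert (M * ln (1 + d) <= M * d) by (apply Rmult_le_compat_l; lra).
  assert (0 <= (4 * M - d) ^ 2) by apply pow2_ge_0. lra.
Qed.

(** Up to the common factor [t^(-1/2)], the two sides are the [zeta]-th powers of [1/(rs+t)] and of
    [m/(rs)], with [m] the truncated product. These bases agree up to the factor [2 (1 + d)], where
    [d = |r-s|/sqrt t]. *)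
Lemma Azeta_compare (zeta : R) :
  exists C, 0 < C /\ forall r s t, 0 < r -> 0 < s -> 0 < t ->
    let g := Rpower t (- (1/2)) / Rpower (r * s + t) zeta in
    g <= C * exp ((r - s) ^ 2 / (8 * t)) * Azeta zeta t r s /\
    Azeta zeta t r s <= C * exp ((r - s) ^ 2 / (8 * t)) * g.
Proof.
  set (M := Rabs zeta). exists (exp (M * ln 2 + 2 * M ^ 2)). split; [apply exp_pos|].
  intros r s t Hr Hs Ht g.
  assert (Hrs : 0 < r * s) by now apply Rmult_lt_0_compat.
  assert (Hw : 0 < sqrt t) by now apply sqrt_lt_R0.
  assert (Hww : sqrt t * sqrt t = t) by (apply sqrt_sqrt; lra).
  destruct (truncated_product_bounds r s (sqrt t) Hr Hs Hw) as [H1 H2].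
  rewrite Hww in H1, H2.
  set (d := Rabs (r - s) / sqrt t) in *.
  set (m := Rmin 1 (r / sqrt t) * Rmin 1 (s / sqrt t)) in *.
  assert (Hm1 : 0 < Rmin 1 (r / sqrt t)) by (apply Rmin_glb_lt; [lra|now apply Rdiv_lt_0_compat]).
  assert (Hm2 : 0 < Rmin 1 (s / sqrt t)) by (apply Rmin_glb_lt; [lra|now apply Rdiv_lt_0_compat]).
  assert (Hm : 0 < m) by now apply Rmult_lt_0_compat.
  assert (Hd : 0 <= d) by (apply Rmult_le_pos; [apply Rabs_pos|left; now apply Rinv_0_lt_compat]).
  assert (Hd2 : (r - s) ^ 2 / (8 * t) = d ^ 2 / 8).
  { unfold d. rewrite <- (pow2_abs (r - s)).
    replace (8 * t) with (8 * (sqrt t * sqrt t)) by (rewrite Hww; ring). field. lra. }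
  assert (HA : Azeta zeta t r s = Rpower (m / (r * s)) zeta * Rpower t (- (1/2))).
  { unfold Azeta. change (m / (r * s)) with (m * / (r * s)).
    unfold m. rewrite <- !Rpower_mult_distr; trivial.
    apply Rinv_0_lt_compat; lra. }
  assert (Hg : g = Rpower (/ (r * s + t)) zeta * Rpower t (- (1/2))).
  { unfold g. rewrite Rpower_Rinv, (Rpower_Ropp (r * s + t)) by lra. unfold Rdiv. ring. }
  assert (HtP := Rpower_pos t (- (1/2))).
  assert (HC := Rpower_2_1p_le_gauss M d (Rabs_pos _) Hd).
  set (CC := exp (M * ln 2 + 2 * M ^ 2) * exp (d ^ 2 / 8)) in *.
  assert (Hi : 0 < / (r * s + t)) by (apply Rinv_0_lt_compat; lra).
  assert (Hmr : 0 < m / (r * s)) by now apply Rdiv_lt_0_compat.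
  assert (B1 : / (r * s + t) <= 2 * (1 + d) * (m / (r * s))).
  { apply (Rmult_le_reg_l (r * s + t)); [lra|]. rewrite Rinv_r by lra.
    apply (Rmult_le_reg_l (r * s)); trivial.
    replace (r * s * ((r * s + t) * (2 * (1 + d) * (m / (r * s))))) with
      (2 * ((1 + d) * (m * (r * s + t)))) by (field; lra). lra. }
  assert (B2 : m / (r * s) <= 2 * (1 + d) * / (r * s + t)).
  { apply (Rmult_le_reg_l (r * s + t)); [lra|].
    apply (Rmult_le_reg_l (r * s)); trivial.
    replace (r * s * ((r * s + t) * (m / (r * s)))) with (m * (r * s + t)) by (field; lra).
    replace (r * s * ((r * s + t) * (2 * (1 + d) * / (r * s + t)))) with (2 * (r * s) * (1 + d)) by (field; lra).
    nra. }
  rewrite Hd2. fold CC. rewrite HA, Hg. split.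
  - assert (H := Rpower_compare _ _ _ zeta Hi Hmr B1 B2). fold M in H.
    rewrite <- Rmult_assoc. apply Rmult_le_compat_r; [lra|].
    apply Rle_trans with (1 := H). apply Rmult_le_compat_r; trivial. left; apply Rpower_pos.
  - assert (H := Rpower_compare _ _ _ zeta Hmr Hi B2 B1). fold M in H.
    rewrite <- Rmult_assoc. apply Rmult_le_compat_r; [lra|].
    apply Rle_trans with (1 := H). apply Rmult_le_compat_r; trivial. left; apply Rpower_pos.
Qed.

Lemma p2_bounds (zeta : R) : -1/2 < zeta ->
  exists c1 c2 c3 c4 c5 c6 c7 c8 : R,
     0 < c1 /\ 0 < c2 /\ 0 < c3 /\ 0 < c4 /\ 0 < c5 /\ 0 < c6 /\ 0 < c7 /\ 0 < c8 /\
     forall r s t : R, 0 < r -> 0 < s -> 0 < t ->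
       c1 * Rpower t (- (1/2)) * exp (- ((r - s) ^ 2 / (c2 * t))) / Rpower (r * s + t) zeta
         <= p2 zeta t r s /\
       p2 zeta t r s
         <= c3 * Rpower t (- (1/2)) * exp (- ((r - s) ^ 2 / (c4 * t))) / Rpower (r * s + t) zeta /\
       c5 * Azeta zeta t r s * exp (- ((r - s) ^ 2 / (c6 * t))) <= p2 zeta t r s /\
       p2 zeta t r s <= c7 * Azeta zeta t r s * exp (- ((r - s) ^ 2 / (c8 * t))).
Proof.
  intros Hz. destruct (p2_gauss_bounds zeta Hz) as [C [HC HB]].
  destruct (Azeta_compare zeta) as [D [HD HA]].
  assert (HCi := Rinv_0_lt_compat _ HC). assert (HDi := Rinv_0_lt_compat _ HD).
  (* With [X = (r-s)^2/(8t)] the kernel decays like [e^(-2X)], and passing to [Azeta] costs [e^X].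
     The upper bound keeps [e^(-X)], hence 8; for the lower bound [e^(-4X)], hence 2, leaves room to
     spare. *)
  exists (/ C), 4, C, 4, (/ C * / D), 2, (C * D), 8.
  do 8 (split; [lra || now apply Rmult_lt_0_compat|]).
  intros r s t Hr Hs Ht. destruct (HB r s t Hr Hs Ht) as [H1 H2].
  destruct (HA r s t Hr Hs Ht) as [H3 H4].
  set (g := Rpower t (- (1/2)) / Rpower (r * s + t) zeta) in *.
  assert (Hg : 0 < g) by (apply Rdiv_lt_0_compat; apply Rpower_pos).
  assert (HX : 0 <= (r - s) ^ 2 / (8 * t)).
  { apply Rmult_le_pos. apply pow2_ge_0. left; apply Rinv_0_lt_compat; lra. }
  set (X := (r - s) ^ 2 / (8 * t)) in *.
  replace ((r - s) ^ 2 / (4 * t)) with (2 * X) by (unfold X; field; lra).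
  replace ((r - s) ^ 2 / (2 * t)) with (4 * X) by (unfold X; field; lra).
  assert (HG : gauss_kernel zeta t r s = exp (- (2 * X)) * g).
  { unfold gauss_kernel, g. replace ((r - s) ^ 2 / (4 * t)) with (2 * X) by (unfold X; field; lra).
    unfold Rdiv. ring. }
  rewrite HG in *. clearbody X.
  replace (/ C * Rpower t (- (1 / 2)) * exp (- (2 * X)) / Rpower (r * s + t) zeta)
    with (/ C * (exp (- (2 * X)) * g)) by (unfold g, Rdiv; ring).
  replace (C * Rpower t (- (1 / 2)) * exp (- (2 * X)) / Rpower (r * s + t) zeta)
    with (C * (exp (- (2 * X)) * g)) by (unfold g, Rdiv; ring).
  assert (L : / C * (exp (- (2 * X)) * g) <= p2 zeta t r s).
  { apply (Rmult_le_reg_l C); trivial. rewrite <- Rmult_assoc, Rinv_r, Rmult_1_l by lra. lra. }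
  repeat split; trivial.
  - apply Rle_trans with (2 := L).
    rewrite !Rmult_assoc. apply Rmult_le_compat_l; [lra|].
    apply (Rmult_le_reg_l D); trivial.
    replace (D * (/ D * (Azeta zeta t r s * exp (- (4 * X))))) with (exp (- (4 * X)) * Azeta zeta t r s)
      by (field; lra).
    apply Rle_trans with (exp (- (4 * X)) * (D * exp X * g)).
    { apply Rmult_le_compat_l; trivial. left; apply exp_pos. }
    replace (exp (- (4 * X)) * (D * exp X * g)) with (D * (exp (- (4 * X) + X) * g)) by (rewrite exp_plus; ring).
    apply Rmult_le_compat_l; [lra|]. apply Rmult_le_compat_r; [lra|]. apply exp_le. lra.
  - apply Rle_trans with (1 := H1).
    rewrite !Rmult_assoc. apply Rmult_le_compat_l; [lra|].
    apply Rle_trans with (exp (- (2 * X)) * (D * exp X * Azeta zeta t r s)).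
    { apply Rmult_le_compat_l; trivial. left; apply exp_pos. }
    right. replace (- X) with (- (2 * X) + X) by ring. rewrite exp_plus. ring.
Qed.

(** * Integrals against the stable density *)

Lemma one_minus_exp_ge (x : R) : 0 <= x <= 1 -> x / 2 <= 1 - exp (- x).
Proof.
  intros Hx. assert (H := exp_ineq1_le x). assert (He := exp_pos x).
  rewrite exp_Ropp. apply (Rmult_le_reg_l (exp x)); trivial.
  rewrite Rmult_minus_distr_l, Rinv_r by lra.
  assert (0 <= (exp x - (1 + x)) * (1 - x / 2)) by (apply Rmult_le_pos; lra). nra.
Qed.

Lemma one_minus_exp_le (x : R) : 1 - exp (- x) <= x.
Proof. generalize (exp_ineq1_le (- x)). lra. Qed.

Lemma exp_neg1_le_half : exp (- (1)) <= / 2.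
Proof. generalize (one_minus_exp_ge 1 ltac:(lra)). lra. Qed.

Lemma exp_neg_le1 (x : R) : 0 <= x -> exp (- x) <= 1.
Proof. intros Hx. rewrite <- exp_0. apply exp_le. lra. Qed.

Definition stable_laplace (beta t : R) (dens : R -> R) : Prop :=
  (forall tau, 0 < tau -> 0 <= dens tau) /\
  (forall lambda, 0 <= lambda ->
     is_RInt_gen (fun tau => exp (- (tau * lambda)) * dens tau)
       (at_right 0) (Rbar_locally p_infty) (exp (- (t * rpow lambda beta)))).

Lemma rpow_Rpower (x y : R) : 0 < x -> rpow x y = Rpower x y.
Proof. intros Hx. unfold rpow. destruct (Rle_dec x 0); [lra|reflexivity]. Qed.

Lemma rpow_0 (y : R) : rpow 0 y = 0.
Proof. unfold rpow. destruct (Rle_dec 0 0); [reflexivity|lra]. Qed.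

Section StableDensity.

Variables (beta t : R) (dens : R -> R).
Hypothesis HS : stable_laplace beta t dens.

Lemma stable_nonneg (tau : R) : 0 < tau -> 0 <= dens tau.
Proof. apply HS. Qed.

Lemma stable_exp_gen (lambda : R) : 0 < lambda ->
  is_RInt_gen (fun tau => exp (- (tau * lambda)) * dens tau)
    (at_right 0) (Rbar_locally p_infty) (exp (- (t * Rpower lambda beta))).
Proof.
  intros Hl. rewrite <- rpow_Rpower by trivial. apply HS. lra.
Qed.

(** The Laplace transform at [lambda = 0], where the convention [rpow 0 y = 0] gives the value
    [exp 0]. *)
Lemma stable_mass_gen : is_RInt_gen dens (at_right 0) (Rbar_locally p_infty) 1.
Proof.
  assert (H := proj2 HS 0 (Rle_refl 0)). rewrite rpow_0, Rmult_0_r, Ropp_0, exp_0 in H.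
  revert H. apply is_RInt_gen_ext.
  apply filter_forall. intros ab x _. now rewrite Rmult_0_r, Ropp_0, exp_0, Rmult_1_l.
Qed.

Lemma stable_ex_RInt (a b : R) : 0 < a -> a <= b -> ex_RInt dens a b.
Proof. apply (is_RInt_gen_ex_RInt dens 1 a b stable_mass_gen). Qed.

Lemma stable_ex_RInt_mult (f : R -> R) (a b : R) : 0 < a -> a <= b ->
  (forall x, 0 < x -> continuous f x) -> ex_RInt (fun x => f x * dens x) a b.
Proof.
  intros Ha Hab Hf. apply ex_RInt_continuous_mult; trivial.
  - intros x Hx. apply Hf. lra.
  - now apply stable_ex_RInt.
Qed.

Lemma stable_one_minus_exp_gen (lambda : R) : 0 < lambda ->
  is_RInt_gen (fun tau => (1 - exp (- (tau * lambda))) * dens tau)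
    (at_right 0) (Rbar_locally p_infty) (1 - exp (- (t * Rpower lambda beta))).
Proof.
  intros Hl.
  assert (H := is_RInt_gen_minus _ _ _ _ stable_mass_gen (stable_exp_gen lambda Hl)).
  revert H. apply is_RInt_gen_ext. apply filter_forall. intros ab x _.
  unfold minus, plus, opp; simpl. ring.
Qed.

Lemma stable_RInt_exp_le (lambda a b : R) : 0 < lambda -> 0 < a -> a <= b ->
  RInt (fun tau => exp (- (tau * lambda)) * dens tau) a b <= exp (- (t * Rpower lambda beta)).
Proof.
  intros Hl Ha Hab. apply is_RInt_gen_nonneg_ub; trivial.
  - intros x Hx. apply Rmult_le_pos. left; apply exp_pos. now apply stable_nonneg.
  - now apply stable_exp_gen.
Qed.

Lemma stable_RInt_one_minus_exp_le (lambda a b : R) : 0 < lambda -> 0 < a -> a <= b ->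
  RInt (fun tau => (1 - exp (- (tau * lambda))) * dens tau) a b <= 1 - exp (- (t * Rpower lambda beta)).
Proof.
  intros Hl Ha Hab. apply is_RInt_gen_nonneg_ub; trivial.
  - intros x Hx. apply Rmult_le_pos; [|now apply stable_nonneg].
    assert (0 < x * lambda) by now apply Rmult_lt_0_compat.
    generalize (exp_neg_le1 (x * lambda)); lra.
  - now apply stable_one_minus_exp_gen.
Qed.

(* The combination [g u = (1-e^(-u)) - 2 (1-e^(-u/B)) - (2/D) (1-e^(-D u))] is at most the
   indicator of [[1/D, B]], while its mean at scale [lambda] is of order [t lambda^beta]. *)
Lemma stable_annulus_mass_ge (B D lambda : R) :
  0 < beta < 1 -> 0 < t -> 1 < B -> 1 < D ->
  Rpower B (- beta) <= / 16 -> Rpower D (beta - 1) <= / 16 ->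
  0 < lambda -> t * Rpower lambda beta <= 1 ->
  / 4 * (t * Rpower lambda beta) <= RInt dens (/ (D * lambda)) (B / lambda).
Proof.
  intros Hbeta Ht HB HD HBb HDb Hl Hx.
  set (x := t * Rpower lambda beta) in *.
  assert (Hx0 : 0 < x) by (apply Rmult_lt_0_compat; [trivial|apply Rpower_pos]).
  set (k := fun mu tau => (1 - exp (- (tau * mu))) * dens tau).
  assert (HlB : 0 < lambda / B) by (apply Rdiv_lt_0_compat; lra).
  assert (HDl : 0 < D * lambda) by (apply Rmult_lt_0_compat; lra).
  set (g := fun tau => k lambda tau - 2 * k (lambda / B) tau - 2 / D * k (D * lambda) tau).
  set (v := (1 - exp (- x)) - 2 * (1 - exp (- (t * Rpower (lambda / B) beta)))
     - 2 / D * (1 - exp (- (t * Rpower (D * lambda) beta)))).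
  assert (Hg : is_RInt_gen g (at_right 0) (Rbar_locally p_infty) v).
  { unfold g, v.
    apply (is_RInt_gen_minus (fun tau => k lambda tau - 2 * k (lambda / B) tau)).
    - apply (is_RInt_gen_minus (k lambda)).
      + now apply stable_one_minus_exp_gen.
      + apply (is_RInt_gen_scal (k (lambda / B))). now apply stable_one_minus_exp_gen.
    - apply (is_RInt_gen_scal (k (D * lambda))). now apply stable_one_minus_exp_gen. }
  (* The first term is at least [x/2], as [x <= 1]; by the choice of [B] and [D] each subtracted
     term is at most [2 x / 16]. *)
  assert (Hv : / 4 * x <= v).
  { unfold v. assert (H1 := one_minus_exp_ge x ltac:(lra)).
    assert (H2 := one_minus_exp_le (t * Rpower (lambda / B) beta)).
    assert (H3 := one_minus_exp_le (t * Rpower (D * lambda) beta)).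
    assert (E2 : t * Rpower (lambda / B) beta = x * Rpower B (- beta)).
    { unfold x. rewrite Rpower_Rdiv, Rpower_Ropp by lra. unfold Rdiv. ring. }
    assert (E3 : 2 / D * (t * Rpower (D * lambda) beta) = 2 * x * Rpower D (beta - 1)).
    { unfold x. rewrite <- Rpower_mult_distr by lra. unfold Rminus.
      rewrite Rpower_plus, Rpower_Ropp, Rpower_1 by lra. field. lra. }
    assert (H4 : 2 / D * (1 - exp (- (t * Rpower (D * lambda) beta))) <= 2 * x * Rpower D (beta - 1)).
    { rewrite <- E3. apply Rmult_le_compat_l; trivial. left; apply Rdiv_lt_0_compat; lra. }
    rewrite E2 in H2 |- *. nra. }
  apply Rle_trans with (1 := Hv).
  apply (is_RInt_gen_le_bound g v); trivial.
  set (p := / (D * lambda)). set (q := B / lambda).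
  assert (Hp : 0 < p) by now apply Rinv_0_lt_compat.
  assert (Hpl : p * (D * lambda) = 1) by (unfold p; field; lra).
  assert (Hql : q * lambda = B) by (unfold q; field; lra).
  assert (Hpq : p <= q).
  { apply (Rmult_le_reg_r lambda); trivial. rewrite Hql.
    assert (p * lambda <= 1); [|lra].
    assert (0 < p * lambda) by now apply Rmult_lt_0_compat. nra. }
  exists p, q. split; trivial. intros a b Ha Hb.
  assert (Hex : forall c d, 0 < c -> c <= d -> ex_RInt g c d).
  { intros c d Hc Hd. apply (is_RInt_gen_ex_RInt g v); trivial. }
  rewrite <- (RInt_Chasles g a p b), <- (RInt_Chasles g p q b) by (apply Hex; lra).
  change (RInt g a p + (RInt g p q + RInt g q b) <= RInt dens p q).
  assert (Hexp : forall tau, 0 < tau -> forall mu, 0 < mu -> 0 <= 1 - exp (- (tau * mu)) <= 1).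
  { intros tau Htau mu Hmu. assert (0 < tau * mu) by now apply Rmult_lt_0_compat.
    generalize (exp_neg_le1 (tau * mu)) (exp_pos (- (tau * mu))). lra. }
  assert (H2D : 0 < 2 / D) by (apply Rdiv_lt_0_compat; lra).
  assert (Hneg : forall c d, 0 < c -> c <= d -> (forall tau, c < tau < d -> g tau <= 0) -> RInt g c d <= 0).
  { intros c d Hc Hd Hgn. replace 0 with (RInt (fun _ => 0) c d).
    - apply RInt_le; auto. apply ex_RInt_const.
    - rewrite RInt_const. unfold scal; simpl; unfold mult; simpl; ring. }
  (* Here [D u < 1] with [u = tau lambda], so [(2/D) (1 - e^(-D u)) >= u >= 1 - e^(-u)]: the last
     term alone makes [g] nonpositive. *)
  assert (I1 : RInt g a p <= 0).
  { apply Hneg; try lra. intros tau Htau. unfold g, k.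
    assert (HSt := stable_nonneg tau ltac:(lra)).
    assert (Hu : 0 < tau * (D * lambda) < 1).
    { split. apply Rmult_lt_0_compat; lra. rewrite <- Hpl. apply Rmult_lt_compat_r; lra. }
    assert (K1 := one_minus_exp_ge (tau * (D * lambda)) ltac:(lra)).
    assert (K2 := one_minus_exp_le (tau * lambda)).
    assert (K3 := Hexp tau ltac:(lra) (lambda / B) HlB).
    assert (K4 : tau * lambda <= 2 / D * (1 - exp (- (tau * (D * lambda))))).
    { replace (tau * lambda) with (2 / D * (tau * (D * lambda) / 2)) by (field; lra).
      apply Rmult_le_compat_l; lra. }
    replace ((1 - exp (- (tau * lambda))) * dens tau - 2 * ((1 - exp (- (tau * (lambda / B)))) * dens tau) -
      2 / D * ((1 - exp (- (tau * (D * lambda)))) * dens tau))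
      with (- ((2 / D * (1 - exp (- (tau * (D * lambda)))) + 2 * (1 - exp (- (tau * (lambda / B))))
          - (1 - exp (- (tau * lambda)))) * dens tau)) by ring.
    apply Ropp_le_cancel. rewrite Ropp_involutive, Ropp_0. apply Rmult_le_pos; lra. }
  (* Here [u > B], so [2 (1 - e^(-u/B)) >= 2 (1 - 1/e) >= 1]: the middle term alone suffices. *)
  assert (I3 : RInt g q b <= 0).
  { apply Hneg; try lra. intros tau Htau. unfold g, k.
    assert (HSt := stable_nonneg tau ltac:(lra)).
    assert (Hu : 1 < tau * (lambda / B)).
    { apply (Rmult_lt_reg_r B); [lra|]. replace (tau * (lambda / B) * B) with (tau * lambda) by (field; lra).
      rewrite Rmult_1_l, <- Hql. apply Rmult_lt_compat_r; lra. }
    assert (K1 := exp_neg1_le_half).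
    assert (K2 : exp (- (tau * (lambda / B))) <= exp (- (1))) by (apply exp_le; lra).
    assert (K3 := Hexp tau ltac:(lra) lambda Hl).
    assert (K4 := Hexp tau ltac:(lra) (D * lambda) HDl).
    assert (K5 : 0 <= 2 / D * (1 - exp (- (tau * (D * lambda))))) by (apply Rmult_le_pos; lra).
    replace ((1 - exp (- (tau * lambda))) * dens tau - 2 * ((1 - exp (- (tau * (lambda / B)))) * dens tau) -
      2 / D * ((1 - exp (- (tau * (D * lambda)))) * dens tau))
      with (- ((2 / D * (1 - exp (- (tau * (D * lambda)))) + 2 * (1 - exp (- (tau * (lambda / B))))
          - (1 - exp (- (tau * lambda)))) * dens tau)) by ring.
    apply Ropp_le_cancel. rewrite Ropp_involutive, Ropp_0. apply Rmult_le_pos; lra. }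
  assert (I2 : RInt g p q <= RInt dens p q).
  { apply RInt_le; trivial.
    - apply Hex; lra.
    - now apply stable_ex_RInt.
    - intros tau Htau. unfold g, k. assert (HSt := stable_nonneg tau ltac:(lra)).
      assert (K2 := Hexp tau ltac:(lra) (lambda / B) HlB).
      assert (K3 := Hexp tau ltac:(lra) lambda Hl).
      assert (K4 := Hexp tau ltac:(lra) (D * lambda) HDl).
      assert (K5 : 0 <= 2 / D * (1 - exp (- (tau * (D * lambda))))) by (apply Rmult_le_pos; lra).
      replace ((1 - exp (- (tau * lambda))) * dens tau - 2 * ((1 - exp (- (tau * (lambda / B)))) * dens tau) -
        2 / D * ((1 - exp (- (tau * (D * lambda)))) * dens tau))
        with (((1 - exp (- (tau * lambda))) - 2 / D * (1 - exp (- (tau * (D * lambda))))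
          - 2 * (1 - exp (- (tau * (lambda / B))))) * dens tau) by ring.
      rewrite <- (Rmult_1_l (dens tau)) at 2. apply Rmult_le_compat_r; lra. }
  lra.
Qed.

(** A truncation of the series of [j^n e^(-j u)] over [j >= 1], [u = tau lambda], which behaves at
    least like [u^(-n)] near 0. In the successor branch [N] is the full index, so the sum starts at
    [j = 1]. Being finite, it can be integrated term by term. *)
Fixpoint exp_comb (n : nat) (lambda : R) (N : nat) (tau : R) : R :=
  match N with
  | O => 0
  | S K => exp_comb n lambda K tau + INR N ^ n * exp (- (tau * (INR N * lambda)))
  end.

Lemma exp_comb_nonneg (n : nat) (lambda : R) (N : nat) (tau : R) : 0 <= exp_comb n lambda N tau.
Proof.
  induction N as [|N IH]; cbn -[INR]; [lra|].
  apply Rplus_le_le_0_compat; trivial.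
  apply Rmult_le_pos; [apply pow_le, pos_INR|left; apply exp_pos].
Qed.

(* With [N] the integer just above [1/u], the summand [N^n e^(-N u)] is at least [u^(-n) e^(-2)]. *)
Lemma inv_pow_le_exp_comb (n : nat) (lambda : R) (N : nat) (tau : R) :
  0 < tau * lambda <= 1 -> / (tau * lambda) < INR N ->
  / (tau * lambda) ^ n <= exp 2 * exp_comb n lambda N tau.
Proof.
  intros Hu. induction N as [|N IH]; intros HN.
  - simpl in HN. assert (0 < / (tau * lambda)) by now apply Rinv_0_lt_compat. lra.
  - assert (H2 := exp_pos 2). cbn -[INR].
    assert (Hp : 0 <= INR (S N) ^ n * exp (- (tau * (INR (S N) * lambda)))).
    { apply Rmult_le_pos; [apply pow_le, pos_INR|left; apply exp_pos]. }
    destruct (Rlt_dec (/ (tau * lambda)) (INR N)) as [H|H].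
    + specialize (IH H). nra.
    + assert (Hc := exp_comb_nonneg n lambda N tau).
      apply Rle_trans with (exp 2 * (INR (S N) ^ n * exp (- (tau * (INR (S N) * lambda))))); [|nra].
      assert (Hle : tau * (INR (S N) * lambda) <= 2).
      { rewrite S_INR. apply Rnot_lt_le in H.
        assert (INR N * (tau * lambda) <= 1).
        { apply (Rmult_le_compat_r (tau * lambda)) in H; [|lra]. rewrite Rinv_l in H; lra. }
        lra. }
      replace (exp 2 * (INR (S N) ^ n * exp (- (tau * (INR (S N) * lambda)))))
        with (INR (S N) ^ n * exp (2 + - (tau * (INR (S N) * lambda)))) by (rewrite exp_plus; ring).
      apply Rle_trans with (INR (S N) ^ n * 1).
      * rewrite Rmult_1_r, <- pow_inv. apply pow_incr. split; [|lra].
        left; apply Rinv_0_lt_compat; lra.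
      * apply Rmult_le_compat_l. apply pow_le, pos_INR. rewrite <- exp_0. apply exp_le. lra.
Qed.

(** When [t lambda^beta = 1], the Laplace transform at [j lambda] is [exp (- j^beta)].
    [Rpower_le_exp] with exponent [M = (n+2)/beta] gives [j^n exp (- j^beta) <= C/j^2], so the bound
    is uniform in the number of terms. *)
Lemma exp_comb_RInt_bound (n : nat) (lambda a b : R) :
  0 < beta -> 0 < lambda -> t * Rpower lambda beta = 1 -> 0 < a -> a <= b ->
  let M := INR (n + 2) / beta in
  forall N, ex_RInt (fun tau => exp_comb n lambda N tau * dens tau) a b /\
  RInt (fun tau => exp_comb n lambda N tau * dens tau) a b <= 2 * Rpower (2 * (M + 1)) M.
Proof.
  intros Hbeta Hl Hx Ha Hab M.
  set (C := Rpower (2 * (M + 1)) M). assert (HC : 0 < C) by apply Rpower_pos.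
  assert (HM : 0 <= M). { apply Rmult_le_pos. apply pos_INR. left; now apply Rinv_0_lt_compat. }
  assert (Hsum : exists L : nat -> R, L O = 0 /\ forall N, L (S N) = L N + C / (INR N + 1) ^ 2).
  { exists (nat_rect (fun _ => R) 0 (fun N L => L + C / (INR N + 1) ^ 2)). now split. }
  destruct Hsum as [L [HL0 HLS]].
  assert (HL : forall N, L N <= 2 * C).
  { intros N. assert (H := sum_inv_square_variation C L ltac:(lra)).
    assert (H1 : Rabs (L N - L O) <= 2 * C * (1 - / (INR N + 1))).
    { apply H. intros k. rewrite HLS. replace (L k + C / (INR k + 1) ^ 2 - L k) with (C / (INR k + 1) ^ 2) by ring.
      right. apply Rabs_pos_eq. apply Rmult_le_pos. lra. left; apply Rinv_0_lt_compat, pow_lt.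
      generalize (pos_INR k); lra. }
    rewrite HL0, Rminus_0_r in H1. apply Rle_trans with (1 := Rle_abs _). apply Rle_trans with (1 := H1).
    assert (0 < / (INR N + 1)) by (apply Rinv_0_lt_compat; generalize (pos_INR N); lra). nra. }
  intros N. cut (ex_RInt (fun tau => exp_comb n lambda N tau * dens tau) a b /\
    RInt (fun tau => exp_comb n lambda N tau * dens tau) a b <= L N).
  { intros [H1 H2]. split; trivial. apply Rle_trans with (1 := H2). apply HL. }
  induction N as [|N [IH1 IH2]].
  - assert (H0 : is_RInt (fun tau => exp_comb n lambda 0 tau * dens tau) a b 0).
    { apply (is_RInt_ext (fun _ => 0)).
      - intros x _. simpl. now rewrite Rmult_0_l.
      - evar_last. apply (is_RInt_const a b 0). unfold scal; simpl; unfold mult; simpl; ring. }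
    split. eexists; exact H0. rewrite (is_RInt_unique _ _ _ _ H0), HL0. lra.
  - assert (Hy : 0 < INR (S N)) by (apply lt_0_INR; lia).
    assert (HNl : 0 < INR (S N) * lambda) by now apply Rmult_lt_0_compat.
    assert (Hex := is_RInt_gen_ex_RInt _ _ a b (stable_exp_gen (INR (S N) * lambda) HNl) Ha Hab).
    assert (Hle := stable_RInt_exp_le (INR (S N) * lambda) a b HNl Ha Hab).
    assert (H0 := RInt_lincomb2 _ _ a b 1 (INR (S N) ^ n) IH1 Hex).
    apply (is_RInt_ext _ (fun tau => exp_comb n lambda (S N) tau * dens tau)) in H0.
    2:{ intros x _. cbn -[INR]. ring. }
    split. eexists; exact H0. rewrite (is_RInt_unique _ _ _ _ H0), HLS, Rmult_1_l.
    apply Rplus_le_compat; trivial.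
    set (y := INR (S N)) in *.
    assert (Hyn : 0 < y ^ n) by now apply pow_lt.
    apply Rle_trans with (y ^ n * exp (- Rpower y beta)).
    { apply Rmult_le_compat_l; [lra|]. apply Rle_trans with (1 := Hle).
      right. f_equal. f_equal. rewrite <- Rpower_mult_distr by trivial.
      rewrite <- (Rmult_1_r (Rpower y beta)) at 2. rewrite <- Hx. ring. }
    assert (HE := Rpower_le_exp M (Rpower y beta) HM (Rpower_pos _ _)). fold C in HE.
    rewrite Rpower_mult in HE. replace (beta * M) with (INR (n + 2)) in HE by (unfold M; field; lra).
    rewrite Rpower_pow, pow_add in HE by trivial.
    replace (INR N + 1) with y by (unfold y; apply S_INR).
    assert (Hy2 : 0 < y ^ 2) by now apply pow_lt.
    apply (proj1 (Rle_div_r _ _ _ Hy2)). set (w := Rpower y beta) in *.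
    assert (Hw : 0 < w) by apply Rpower_pos.
    apply Rle_trans with (C * exp (w / 2) * exp (- w)).
    + replace (y ^ n * exp (- w) * y ^ 2) with (y ^ n * y ^ 2 * exp (- w)) by ring.
      apply Rmult_le_compat_r; trivial. left; apply exp_pos.
    + rewrite Rmult_assoc, <- exp_plus. apply Rle_trans with (C * 1); [|lra].
      apply Rmult_le_compat_l; [lra|]. rewrite <- exp_0. apply exp_le. lra.
Qed.

Lemma stable_RInt_negative_moment (f : R -> R) (A : R) (n : nat) (lambda a b : R) :
  0 < beta -> 0 < lambda -> t * Rpower lambda beta = 1 -> 0 < a -> a <= b -> 0 <= A ->
  (forall x, 0 < x -> continuous f x) ->
  (forall tau, 0 < tau -> 1 <= tau * lambda -> f tau <= A) ->
  (forall tau, 0 < tau -> tau * lambda <= 1 -> f tau <= A * / (tau * lambda) ^ n) ->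
  let M := INR (n + 2) / beta in
  RInt (fun tau => f tau * dens tau) a b <= A * (1 + exp 2 * (2 * Rpower (2 * (M + 1)) M)).
Proof.
  intros Hbeta Hl Hx Ha Hab HA Hf Hf1 Hf2 M.
  assert (Hal : 0 < a * lambda) by now apply Rmult_lt_0_compat.
  (* The number of exponentials has to exceed [1/(tau lambda)] for all [tau >= a]. It grows as [a]
     tends to 0, but the bound of the integral does not. *)
  destruct (nfloor_ex (/ (a * lambda))) as [N HN]; [left; now apply Rinv_0_lt_compat|].
  destruct (exp_comb_RInt_bound n lambda a b Hbeta Hl Hx Ha Hab (S N)) as [E1 E2].
  fold M in E2.
  assert (Hc := RInt_lincomb2 _ _ a b A (A * exp 2) (stable_ex_RInt a b Ha Hab) E1).
  assert (H2 := exp_pos 2).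
  apply Rle_trans with (RInt (fun x => A * dens x + A * exp 2 * (exp_comb n lambda (S N) x * dens x)) a b).
  - apply RInt_le; trivial.
    + now apply stable_ex_RInt_mult.
    + eexists; exact Hc.
    + intros tau Htau. assert (HSt := stable_nonneg tau ltac:(lra)).
      assert (Hnn := exp_comb_nonneg n lambda (S N) tau).
      replace (A * dens tau + A * exp 2 * (exp_comb n lambda (S N) tau * dens tau))
        with ((A + A * (exp 2 * exp_comb n lambda (S N) tau)) * dens tau) by ring.
      apply Rmult_le_compat_r; trivial.
      assert (0 <= A * (exp 2 * exp_comb n lambda (S N) tau)).
      { apply Rmult_le_pos; trivial. apply Rmult_le_pos; lra. }
      destruct (Rle_dec 1 (tau * lambda)) as [H1|H1].
      * specialize (Hf1 tau ltac:(lra) H1). lra.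
      * specialize (Hf2 tau ltac:(lra) ltac:(lra)).
        assert (Htl : 0 < tau * lambda) by (apply Rmult_lt_0_compat; lra).
        assert (HI : / (tau * lambda) ^ n <= exp 2 * exp_comb n lambda (S N) tau).
        { apply inv_pow_le_exp_comb; [lra|]. rewrite S_INR.
          apply Rle_lt_trans with (2 := proj2 HN). apply Rinv_le_contravar; trivial.
          apply Rmult_le_compat_r; lra. }
        apply (Rmult_le_compat_l A) in HI; lra.
  - rewrite (is_RInt_unique _ _ _ _ Hc).
    assert (H1 := is_RInt_gen_nonneg_ub dens 1 a b stable_nonneg stable_mass_gen Ha Hab).
    assert (HA2 : 0 <= A * exp 2) by (apply Rmult_le_pos; lra).
    apply (Rmult_le_compat_l _ _ _ HA) in H1. apply (Rmult_le_compat_l _ _ _ HA2) in E2. lra.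
Qed.

(** The integral of [1 - e^(-tau lambda)] is [1 - exp (- t lambda^beta)], at most [t lambda^beta]:
    this is where the linear factor [t] of [Qalpha] comes from off the diagonal. *)
Lemma stable_RInt_small_time (f : R -> R) (A lambda a b : R) :
  0 < t -> 0 < lambda -> 0 < a -> a <= b -> 0 <= A ->
  (forall x, 0 < x -> continuous f x) ->
  (forall tau, 0 < tau -> f tau <= A * (1 - exp (- (tau * lambda)))) ->
  RInt (fun tau => f tau * dens tau) a b <= A * (t * Rpower lambda beta).
Proof.
  intros Ht Hl Ha Hab HA Hf HfA.
  assert (H := stable_RInt_one_minus_exp_le lambda a b Hl Ha Hab).
  assert (Hex := is_RInt_gen_ex_RInt _ _ a b (stable_one_minus_exp_gen lambda Hl) Ha Hab).
  assert (Hs : is_RInt (fun tau => A * ((1 - exp (- (tau * lambda))) * dens tau)) a b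
    (A * RInt (fun tau => (1 - exp (- (tau * lambda))) * dens tau) a b)).
  { apply (is_RInt_scal (fun tau => (1 - exp (- (tau * lambda))) * dens tau)).
    apply (RInt_correct (fun tau => (1 - exp (- (tau * lambda))) * dens tau)), Hex. }
  apply Rle_trans with (RInt (fun tau => A * ((1 - exp (- (tau * lambda))) * dens tau)) a b).
  - apply RInt_le; trivial.
    + now apply stable_ex_RInt_mult.
    + eexists; exact Hs.
    + intros tau Htau. rewrite <- Rmult_assoc. apply Rmult_le_compat_r.
      * apply stable_nonneg; lra.
      * apply HfA; lra.
  - rewrite (is_RInt_unique _ _ _ _ Hs).
    apply (Rmult_le_compat_l A); trivial. apply Rle_trans with (1 := H). apply one_minus_exp_le.
Qed.

End StableDensity.

(** * Bounds for the subordinated kernel *)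

Definition diag_kernel (zeta y t : R) : R := Rpower t (- (1/2)) / Rpower (y + t) zeta.

Lemma diag_kernel_pos (zeta y t : R) : 0 < diag_kernel zeta y t.
Proof. apply Rdiv_lt_0_compat; apply Rpower_pos. Qed.

Lemma gauss_kernel_diag (zeta t r s : R) :
  gauss_kernel zeta t r s = diag_kernel zeta (r * s) t * exp (- ((r - s) ^ 2 / (4 * t))).
Proof. unfold gauss_kernel, diag_kernel, Rdiv. ring. Qed.

Lemma diag_kernel_ratio (zeta y m t : R) : 0 < y -> 0 < m -> 0 < t ->
  diag_kernel zeta y t =
  diag_kernel zeta y m * (Rpower (t / m) (- (1/2)) * Rpower ((y + t) / (y + m)) (- zeta)).
Proof.
  intros Hy Hm Ht. unfold diag_kernel. rewrite !Rpower_Rdiv by lra.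
  rewrite (Rpower_Ropp (y + t)), (Rpower_Ropp (y + m)).
  assert (H1 := Rpower_pos m (- (1/2))). assert (H2 := Rpower_pos (y + m) zeta).
  assert (H3 := Rpower_pos (y + t) zeta). field. repeat split; lra.
Qed.

(** For negative [zeta] the second factor increases with time, but [(y+t)/(y+m) <= t/m] bounds the
    product of ratios by [(t/m)^(-1/2-zeta)], and [zeta > -1/2] makes this at most 1. *)
Lemma diag_kernel_large_time (zeta y m t : R) :
  -1/2 < zeta -> 0 < y -> 0 < m -> m <= t -> diag_kernel zeta y t <= diag_kernel zeta y m.
Proof.
  intros Hz Hy Hm Ht. rewrite (diag_kernel_ratio zeta y m t) by lra.
  rewrite <- (Rmult_1_r (diag_kernel zeta y m)) at 2.
  apply Rmult_le_compat_l; [left; apply diag_kernel_pos|].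
  set (u := t / m). set (q := (y + t) / (y + m)).
  assert (Hu : 1 <= u) by (apply Rle_div_r; lra).
  assert (Hq : 1 <= q) by (apply Rle_div_r; lra).
  assert (Hqu : q <= u).
  { apply Rle_div_l; [lra|]. unfold u. replace (t / m * (y + m)) with (y + t + (t - m) * (y / m)) by (field; lra).
    assert (0 <= (t - m) * (y / m)); [|lra]. apply Rmult_le_pos; [lra|].
    left; apply Rdiv_lt_0_compat; lra. }
  destruct (Rle_dec 0 zeta) as [H|H].
  - rewrite <- (Rmult_1_r 1). apply Rmult_le_compat; try (left; apply Rpower_pos); apply Rpower_le1; lra.
  - apply Rle_trans with (Rpower u (- (1/2)) * Rpower u (- zeta)).
    + apply Rmult_le_compat_l. left; apply Rpower_pos. apply Rle_Rpower_l; lra.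
    + rewrite <- Rpower_plus. apply Rpower_le1; lra.
Qed.

(** The ratio [(y+t)/(y+m)] lies between [t/m] and 1, so its power [-zeta], whatever the sign of
    [zeta], is at most [(m/t)^|zeta|]. *)
Lemma diag_kernel_small_time (zeta y m t : R) :
  0 < y -> 0 < m -> 0 < t -> t <= m ->
  diag_kernel zeta y t <= diag_kernel zeta y m * Rpower (m / t) (1/2 + Rabs zeta).
Proof.
  intros Hy Hm Ht0 Ht. rewrite (diag_kernel_ratio zeta y m t) by lra.
  apply Rmult_le_compat_l; [left; apply diag_kernel_pos|].
  assert (Hq : 0 < (y + t) / (y + m)) by (apply Rdiv_lt_0_compat; lra).
  assert (Hq1 : (y + t) / (y + m) <= 1) by (apply Rle_div_l; lra).
  assert (Hv : 1 <= m / t) by (apply Rle_div_r; lra).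
  rewrite Rpower_plus. apply Rmult_le_compat; try (left; apply Rpower_pos).
  - replace (m / t) with (/ (t / m)) by (field; lra). rewrite Rpower_Rinv. lra.
    apply Rdiv_lt_0_compat; lra.
  - assert (H := Rpower_compare (m / t) ((y + t) / (y + m)) 1 (- zeta) Hq Rlt_0_1).
    rewrite Rabs_Ropp in H. unfold Rpower in H at 3. rewrite ln_1, Rmult_0_r, exp_0, !Rmult_1_r in H.
    apply H. lra.
    replace (m / t * ((y + t) / (y + m))) with (1 + (m - t) * y / (t * (y + m))) by (field; lra).
    assert (0 <= (m - t) * y / (t * (y + m))); [|lra].
    apply Rmult_le_pos. apply Rmult_le_pos; lra. left; apply Rinv_0_lt_compat, Rmult_lt_0_compat; lra.
Qed.

(** With [v = m/t >= 1], the left side [v^M e^(-v/4)] is at most a constant times [1/v], whereas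
    [1 - e^(-1/v) >= 1/(2v)]. The exponent [M + 1] in [C] provides the extra power of [v]. *)
Lemma inv_power_gauss_le (M : R) : 0 <= M ->
  exists C, 0 < C /\ forall m t, 0 < m -> 0 < t -> t <= m ->
    Rpower (m / t) M * exp (- (m / (4 * t))) <= C * (1 - exp (- (t * / m))).
Proof.
  intros HM.
  set (C := Rpower (2 * (M + 1 + 1)) (M + 1)). assert (HC : 0 < C) by apply Rpower_pos.
  assert (H2 := Rpower_pos 2 (M + 1)).
  exists (2 * (Rpower 2 (M + 1) * C)). split.
  { apply Rmult_lt_0_compat; [lra|]. now apply Rmult_lt_0_compat. }
  intros m t Hm Ht Htm.
  set (v := m / t). assert (Hv : 1 <= v) by (apply Rle_div_r; lra).
  assert (Hu : t * / m = / v) by (unfold v; field; lra).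
  assert (Hvi : 0 < / v <= 1).
  { split. apply Rinv_0_lt_compat; lra. rewrite <- Rinv_1. apply Rinv_le_contravar; lra. }
  rewrite Hu. assert (Hl := one_minus_exp_ge (/ v) ltac:(lra)).
  assert (HE := Rpower_le_exp (M + 1) (v / 2) ltac:(lra) ltac:(lra)). fold C in HE.
  rewrite Rpower_Rdiv in HE by lra.
  apply (proj1 (Rle_div_l _ _ _ H2)) in HE.
  rewrite Rpower_plus, Rpower_1 in HE by lra.
  replace (m / (4 * t)) with (v / 2 / 2) by (unfold v; field; lra).
  rewrite exp_Ropp. assert (He := exp_pos (v / 2 / 2)).
  apply (proj2 (Rle_div_l _ _ _ He)).
  apply Rle_trans with (2 * (Rpower 2 (M + 1) * C) * (/ v / 2) * exp (v / 2 / 2)).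
  - apply (Rmult_le_reg_r v); [lra|]. apply Rle_trans with (1 := HE).
    right. field. lra.
  - apply Rmult_le_compat_r; [lra|]. apply Rmult_le_compat_l; trivial.
    left; apply Rmult_lt_0_compat; [lra|]. now apply Rmult_lt_0_compat.
Qed.

Lemma Rpower_sqr (x y : R) : 0 < x -> Rpower (x ^ 2) y = Rpower x (2 * y).
Proof.
  intros Hx. rewrite <- Rpower_pow, Rpower_mult by trivial. reflexivity.
Qed.

Definition subord_scale (alpha t r s : R) : R := Rmax (Rpower t (2 / alpha)) ((r - s) ^ 2).

Lemma subord_scale_pos (alpha t r s : R) : 0 < subord_scale alpha t r s.
Proof.
  apply Rlt_le_trans with (Rpower t (2 / alpha)). apply Rpower_pos. apply Rmax_l.
Qed.

(** The quantity [X] equals [t / W] with [W = m^((1+alpha)/2) (rs+m)^zeta], so it is enough to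
    compare [W] with the two summands [D1], [D2] of the denominator. Each is at most a multiple of
    [W], and the one belonging to the larger entry of the maximum [m] is also bounded below by a
    multiple of [W]. *)
Lemma Qalpha_compare (zeta alpha : R) : -1/2 < zeta -> 0 < alpha ->
  exists C, 0 < C /\ forall r s t, 0 < r -> 0 < s -> 0 < t ->
    let m := subord_scale alpha t r s in
    let X := t * Rpower m (- (alpha / 2)) * diag_kernel zeta (r * s) m in
    Qalpha zeta alpha t r s <= C * X /\ X <= C * Qalpha zeta alpha t r s.
Proof.
  intros Hz Ha.
  set (e := (1 + alpha) / 2).
  set (A := Rpower 10 (Rabs zeta)).
  assert (HA : 1 <= A) by (apply Rpower_ge1; [lra|apply Rabs_pos]).
  assert (HA4 : forall c, 1 <= c <= 10 -> Rpower c (Rabs zeta) <= A).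
  { intros c Hc. apply Rle_Rpower_l. apply Rabs_pos. lra. }
  exists (2 * A). split; [lra|]. intros r s t Hr Hs Ht m X.
  assert (Hrs : 0 < r * s) by now apply Rmult_lt_0_compat.
  set (T := Rpower t (2 / alpha)) in *. assert (HT : 0 < T) by apply Rpower_pos.
  assert (Hm : 0 < m) by apply subord_scale_pos.
  assert (HTm : T <= m) by apply Rmax_l. assert (Hdm : (r - s) ^ 2 <= m) by apply Rmax_r.
  set (N := r * s + m). assert (HN : 0 < N) by (unfold N; lra).
  set (W := Rpower m e * Rpower N zeta).
  assert (HW : 0 < W) by (apply Rmult_lt_0_compat; apply Rpower_pos).
  assert (HX : X = t / W).
  { unfold X, diag_kernel, W. fold N.
    replace e with (- (- (alpha / 2) + - (1/2))) by (unfold e; field).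
    rewrite (Rpower_Ropp m (_ + _)), Rpower_plus.
    assert (H1 := Rpower_pos m (- (alpha / 2))). assert (H2 := Rpower_pos m (- (1/2))).
    assert (H3 := Rpower_pos N zeta). field. lra. }
  set (w := Rpower t (1 / alpha)). assert (Hw : 0 < w) by apply Rpower_pos.
  assert (Hw2 : w ^ 2 = T).
  { unfold w, T. rewrite <- Rpower_pow, Rpower_mult by apply Rpower_pos. f_equal. change (INR 2) with 2. field. lra. }
  set (D1 := rpow (Rabs (r - s)) (1 + alpha) * Rpower (r + s) (2 * zeta)).
  set (D2 := Rpower t ((1 + alpha) / alpha) * Rpower (w + r + s) (2 * zeta)).
  assert (HD2 : D2 = Rpower T e * Rpower ((w + r + s) ^ 2) zeta).
  { unfold D2. rewrite Rpower_sqr by lra. f_equal. unfold T. rewrite Rpower_mult. f_equal. unfold e. field. lra. }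
  assert (HTe : 0 < Rpower T e) by apply Rpower_pos.
  assert (HNz : 0 < Rpower N zeta) by apply Rpower_pos.
  assert (Hme : 0 < Rpower m e) by apply Rpower_pos.
  assert (He : 1/2 < e) by (unfold e; lra).
  (* Both are comparable with [T + (r-s)^2 + rs], since [w^2 = T] and [(r+s)^2 = (r-s)^2 + 4rs]; 10
     is a convenient common constant. *)
  assert (Hb1 : N <= 10 * (w + r + s) ^ 2 /\ (w + r + s) ^ 2 <= 10 * N).
  { assert (m <= T + (r - s) ^ 2).
    { unfold m, subord_scale. fold T. apply Rmax_lub; [|lra]. generalize (pow2_ge_0 (r - s)); lra. }
    assert (0 <= (w - (r + s)) ^ 2) by apply pow2_ge_0.
    assert (0 < w * r) by now apply Rmult_lt_0_compat. assert (0 < w * s) by now apply Rmult_lt_0_compat.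
    unfold N. split; nra. }
  assert (HD2pos : 0 < D2) by (apply Rmult_lt_0_compat; apply Rpower_pos).
  assert (HD2u : D2 <= A * W).
  { rewrite HD2. unfold W.
    assert (H := Rpower_compare 10 ((w + r + s) ^ 2) N zeta ltac:(apply pow_lt; lra) HN ltac:(lra) ltac:(lra)).
    fold A in H. replace (A * (Rpower m e * Rpower N zeta)) with (Rpower m e * (A * Rpower N zeta)) by ring.
    apply Rmult_le_compat; trivial; try (left; apply Rpower_pos). apply Rle_Rpower_l; lra. }
  assert (HD1n : 0 <= D1).
  { unfold D1. apply Rmult_le_pos; [|left; apply Rpower_pos].
    unfold rpow. destruct (Rle_dec _ 0); [lra|left; apply Rpower_pos]. }
  assert (HD1pos : r <> s -> D1 = Rpower ((r - s) ^ 2) e * Rpower ((r + s) ^ 2) zeta).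
  { intros Hne. assert (Hd : 0 < Rabs (r - s)) by (apply Rabs_pos_lt; lra).
    unfold D1. rewrite rpow_Rpower by trivial. rewrite <- pow2_abs, !Rpower_sqr by lra.
    f_equal. f_equal. unfold e. field. }
  assert (HD1u : D1 <= A * W).
  { destruct (Req_dec r s) as [->|Hne].
    - unfold D1. rewrite Rminus_diag, Rabs_R0, rpow_0, Rmult_0_l. apply Rmult_le_pos; lra.
    - rewrite HD1pos by trivial.
      assert (Hd2 : 0 < (r - s) ^ 2) by (apply pow2_gt_0; lra).
      assert (Hy : 0 < (r + s) ^ 2) by (apply pow_lt; lra).
      set (d2 := (r - s) ^ 2) in *. set (y := (r + s) ^ 2) in *.
      assert (Hyd : y = d2 + 4 * (r * s)) by (unfold y, d2; ring).
      destruct (Rle_dec 0 zeta) as [Hz0|Hz0].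
      + unfold W. replace (A * (Rpower m e * Rpower N zeta)) with (Rpower m e * (A * Rpower N zeta)) by ring.
        apply Rmult_le_compat; try (left; apply Rpower_pos).
        * apply Rle_Rpower_l; lra.
        * apply Rle_trans with (Rpower (10 * N) zeta).
          -- apply Rle_Rpower_l; [lra|]. unfold N. lra.
          -- rewrite <- Rpower_mult_distr by lra. unfold A. rewrite (Rabs_pos_eq zeta); lra.
      (* For negative [zeta], [y] may be much smaller than [N], so the factors cannot be compared
         separately. Regrouped, both exponents are positive, as [e > 1/2] and [zeta > -1/2], and
         both [d2] and [d2 / y] are bounded by their counterparts, the latter up to 10. *)
      + replace (Rpower d2 e * Rpower y zeta) with (Rpower d2 (e + zeta) * Rpower (d2 / y) (- zeta)).
        2:{ rewrite Rpower_Rdiv, Rpower_plus, !Rpower_Ropp by trivial.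
            field. split; apply Rgt_not_eq, Rpower_pos. }
        replace (A * W) with (A * (Rpower m (e + zeta) * Rpower (m / N) (- zeta))).
        2:{ unfold W. rewrite Rpower_Rdiv, Rpower_plus, !Rpower_Ropp by trivial.
            field. split; apply Rgt_not_eq, Rpower_pos. }
        apply Rle_trans with (Rpower m (e + zeta) * Rpower (10 * (m / N)) (- zeta)).
        * apply Rmult_le_compat; try (left; apply Rpower_pos).
          -- apply Rle_Rpower_l; lra.
          -- apply Rle_Rpower_l; [lra|]. split. now apply Rdiv_lt_0_compat.
             apply (proj2 (Rle_div_l _ _ _ Hy)).
             replace (10 * (m / N) * y) with (10 * m * y / N) by (field; lra).
             apply (proj1 (Rle_div_r _ _ _ HN)). unfold N.
             assert (d2 * (r * s) <= m * (r * s)) by (apply Rmult_le_compat_r; lra).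
             assert (0 < m * (r * s)) by now apply Rmult_lt_0_compat.
             assert (0 < m * d2) by now apply Rmult_lt_0_compat.
             rewrite Hyd. lra.
        * assert (HmN : 0 < m / N) by now apply Rdiv_lt_0_compat.
          rewrite <- Rpower_mult_distr by lra. unfold A. rewrite (Rabs_left1 zeta) by lra. lra. }
  assert (HWD : W <= A * (D1 + D2)).
  { destruct (Rle_dec ((r - s) ^ 2) T) as [Hle|Hgt].
    - assert (HmT : m = T) by (unfold m, subord_scale; fold T; now apply Rmax_left).
      apply Rle_trans with (A * D2); [|apply Rmult_le_compat_l; lra].
      rewrite HD2. unfold W. rewrite HmT in *.
      assert (H := Rpower_compare 10 N ((w + r + s) ^ 2) zeta HN ltac:(apply pow_lt; lra) ltac:(lra) ltac:(lra)).
      fold A in H. replace (A * (Rpower T e * Rpower ((w + r + s) ^ 2) zeta))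
        with (Rpower T e * (A * Rpower ((w + r + s) ^ 2) zeta)) by ring.
      apply Rmult_le_compat_l; lra.
    - assert (Hmd : m = (r - s) ^ 2) by (unfold m, subord_scale; fold T; apply Rmax_right; lra).
      assert (Hne : r <> s). { intros ->. apply Hgt. rewrite Rminus_diag. simpl. lra. }
      apply Rle_trans with (A * D1); [|apply Rmult_le_compat_l; lra].
      rewrite HD1pos by trivial. rewrite <- Hmd. unfold W.
      assert (Hy : (r + s) ^ 2 = m + 4 * (r * s)) by (rewrite Hmd; ring).
      assert (H := Rpower_compare 10 N ((r + s) ^ 2) zeta HN ltac:(apply pow_lt; lra)
         ltac:(rewrite Hy; unfold N; lra) ltac:(rewrite Hy; unfold N; lra)).
      fold A in H. replace (A * (Rpower m e * Rpower ((r + s) ^ 2) zeta))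
        with (Rpower m e * (A * Rpower ((r + s) ^ 2) zeta)) by ring.
      apply Rmult_le_compat_l; lra. }
  assert (HQ : Qalpha zeta alpha t r s = t / (D1 + D2)) by reflexivity.
  rewrite HQ, HX. assert (HD : 0 < D1 + D2) by lra. split.
  - apply (proj2 (Rle_div_l _ _ _ HD)).
    replace (2 * A * (t / W) * (D1 + D2)) with (t * (2 * (A * (D1 + D2))) / W) by (field; lra).
    apply (proj1 (Rle_div_r _ _ _ HW)). apply Rmult_le_compat_l; lra.
  - apply (proj2 (Rle_div_l _ _ _ HW)).
    replace (2 * A * (t / (D1 + D2)) * W) with (t * (2 * (A * W)) / (D1 + D2)) by (field; lra).
    apply (proj1 (Rle_div_r _ _ _ HD)). apply Rmult_le_compat_l; lra.
Qed.

Lemma palpha_scale_bounds (zeta alpha : R) : -1/2 < zeta -> 0 < alpha < 2 ->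
  exists C, 0 < C /\ forall sigma, stable_subordinator_density alpha sigma ->
    forall r s t, 0 < r -> 0 < s -> 0 < t ->
    let m := subord_scale alpha t r s in
    let X := t * Rpower m (- (alpha / 2)) * diag_kernel zeta (r * s) m in
    palpha zeta sigma t r s <= C * X /\ X <= C * palpha zeta sigma t r s.
Proof.
  intros Hz Ha. set (beta := alpha / 2). assert (Hb : 0 < beta < 1) by (unfold beta; lra).
  destruct (p2_gauss_bounds zeta Hz) as [C0 [HC0 HP]].
  set (M := 1/2 + Rabs zeta). assert (HM : 0 < M) by (unfold M; generalize (Rabs_pos zeta); lra).
  destruct (inv_power_gauss_le M ltac:(lra)) as [C1 [HC1 HI]].
  destruct (nfloor_ex M ltac:(lra)) as [n0 Hn0]. set (n := S n0).
  assert (Hn : M <= INR n) by (unfold n; rewrite S_INR; lra).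
  set (M' := INR (n + 2) / beta).
  set (C2 := 1 + exp 2 * (2 * Rpower (2 * (M' + 1)) M')).
  assert (HC2 : 0 < C2).
  { unfold C2. apply Rplus_lt_0_compat; [lra|]. apply Rmult_lt_0_compat. apply exp_pos.
    apply Rmult_lt_0_compat. lra. apply Rpower_pos. }
  (* These make [B^(-beta)] and [D^(beta-1)] equal to [1/16], as [stable_annulus_mass_ge]
     requires. *)
  set (B := Rpower 16 (/ beta)). set (D := Rpower 16 (/ (1 - beta))).
  assert (HB : 1 < B).
  { unfold B. apply Rle_lt_trans with (Rpower 16 0); [rewrite Rpower_O; lra|].
    apply Rpower_lt; [lra|]. apply Rinv_0_lt_compat; lra. }
  assert (HD : 1 < D).
  { unfold D. apply Rle_lt_trans with (Rpower 16 0); [rewrite Rpower_O; lra|].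
    apply Rpower_lt; [lra|]. apply Rinv_0_lt_compat; lra. }
  assert (HBb : Rpower B (- beta) <= / 16).
  { unfold B. rewrite Rpower_mult. replace (/ beta * - beta) with (- (1)) by (field; lra).
    rewrite Rpower_Ropp, Rpower_1; lra. }
  assert (HDb : Rpower D (beta - 1) <= / 16).
  { unfold D. rewrite Rpower_mult. replace (/ (1 - beta) * (beta - 1)) with (- (1)) by (field; lra).
    rewrite Rpower_Ropp, Rpower_1; lra. }
  set (CB := Rpower B M). assert (HCB : 0 < CB) by apply Rpower_pos.
  assert (HeD := exp_pos (D / 4)).
  (* The 4 is from the mass of the annulus, [C0] from the Gaussian bounds, [CB] bounds the decay of
     the diagonal kernel up to time [B m], and [exp (D/4)] the loss in the exponential down to time
     [m/D]. *)
  set (CL := 4 * (C0 * (CB * exp (D / 4)))).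
  assert (HCL : 0 < CL) by (unfold CL; repeat (apply Rmult_lt_0_compat; [lra|]); lra).
  set (CU := C0 * (C1 + 2) + C0 * C2).
  assert (HCU : 0 < CU).
  { unfold CU. apply Rplus_lt_0_compat; apply Rmult_lt_0_compat; lra. }
  exists (CU + CL). split; [lra|].
  intros sigma Hsig r s t Hr Hs Ht m X.
  assert (Hrs : 0 < r * s) by now apply Rmult_lt_0_compat.
  assert (HS : stable_laplace beta t (sigma t)) by (apply Hsig; trivial).
  set (T := Rpower t (2 / alpha)). assert (HT : 0 < T) by apply Rpower_pos.
  assert (Hm : 0 < m) by apply subord_scale_pos.
  assert (HTm : T <= m) by apply Rmax_l. assert (Hdm : (r - s) ^ 2 <= m) by apply Rmax_r.
  set (lambda := / m). assert (Hl : 0 < lambda) by now apply Rinv_0_lt_compat.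
  set (K := diag_kernel zeta (r * s) m) in *. assert (HK : 0 < K) by apply diag_kernel_pos.
  set (x := t * Rpower lambda beta).
  assert (Hx0 : 0 < x) by (apply Rmult_lt_0_compat; [trivial|apply Rpower_pos]).
  assert (HX : X = x * K).
  { unfold X, x, lambda. rewrite Rpower_Rinv by trivial. reflexivity. }
  assert (HTb : Rpower T beta = t).
  { unfold T. rewrite Rpower_mult. replace (2 / alpha * beta) with 1 by (unfold beta; field; lra).
    now apply Rpower_1. }
  assert (Hxm : x = t / Rpower m beta).
  { unfold x, lambda. now rewrite Rpower_Rinv, Rpower_Ropp by trivial. }
  assert (Hx1 : x <= 1).
  { rewrite Hxm. apply (proj2 (Rle_div_l _ _ _ (Rpower_pos m beta))). rewrite Rmult_1_l, <- HTb.
    apply Rle_Rpower_l; lra. }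
  set (f := fun tau => p2 zeta tau r s).
  assert (Hf : forall tau, 0 < tau -> continuous f tau).
  { intros tau Htau. now apply p2_continuous. }
  assert (Hfpos : forall tau, 0 < tau -> 0 < f tau).
  { intros tau Htau. destruct (HP r s tau Hr Hs Htau) as [_ H].
    assert (Hg := gauss_kernel_pos zeta tau r s). apply (Rmult_lt_reg_l C0); trivial. unfold f. lra. }
  assert (Hd2 : 0 <= (r - s) ^ 2) by apply pow2_ge_0.
  assert (Hgd : forall tau, 0 < tau -> gauss_kernel zeta tau r s <= diag_kernel zeta (r * s) tau).
  { intros tau Htau. rewrite gauss_kernel_diag.
    rewrite <- (Rmult_1_r (diag_kernel zeta (r * s) tau)) at 2.
    apply Rmult_le_compat_l. left; apply diag_kernel_pos. apply exp_neg_le1.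
    apply Rmult_le_pos; trivial. left; apply Rinv_0_lt_compat; lra. }
  assert (Hfu : forall tau, 0 < tau -> f tau <= C0 * gauss_kernel zeta tau r s).
  { intros tau Htau. apply (HP r s tau Hr Hs Htau). }
  assert (HtlE : forall tau, tau * lambda = tau / m) by reflexivity.
  assert (Hupper : forall a b, 0 < a -> a <= b -> RInt (fun tau => f tau * sigma t tau) a b <= CU * X).
  { intros a b Ha0 Hab. rewrite HX.
    assert (HC0K : 0 < C0 * K) by now apply Rmult_lt_0_compat.
    destruct (Rle_dec ((r - s) ^ 2) T) as [Hle|Hgt].
    - assert (HmT : m = T) by (unfold m, subord_scale; now apply Rmax_left).
      assert (Hx : x = 1). { rewrite Hxm, HmT, HTb. field. lra. }
      apply Rle_trans with (C0 * K * C2).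
      + apply (stable_RInt_negative_moment beta t (sigma t) HS f (C0 * K) n lambda); trivial; try lra.
        * intros tau Htau H1. rewrite HtlE in H1. apply (proj2 (Rle_div_r _ _ _ Hm)) in H1.
          apply Rle_trans with (1 := Hfu tau Htau).
          apply Rmult_le_compat_l; [lra|]. apply Rle_trans with (1 := Hgd tau Htau).
          apply diag_kernel_large_time; lra.
        * intros tau Htau H1. rewrite HtlE in H1 |- *. apply (proj1 (Rle_div_l _ _ _ Hm)) in H1.
          apply Rle_trans with (1 := Hfu tau Htau). rewrite Rmult_assoc.
          apply Rmult_le_compat_l; [lra|]. apply Rle_trans with (1 := Hgd tau Htau).
          apply Rle_trans with (K * Rpower (m / tau) M).
          -- apply diag_kernel_small_time; lra.
          -- apply Rmult_le_compat_l; [lra|]. rewrite <- pow_inv.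
             replace (/ (tau / m)) with (m / tau) by (field; lra).
             rewrite <- Rpower_pow by (apply Rdiv_lt_0_compat; lra).
             apply Rle_Rpower; trivial. apply Rle_div_r; lra.
      + rewrite Hx, Rmult_1_l. unfold CU.
        assert (0 < C0 * (C1 + 2) * K).
        { apply Rmult_lt_0_compat; trivial. apply Rmult_lt_0_compat; lra. }
        lra.
    - assert (Hmd : m = (r - s) ^ 2) by (unfold m, subord_scale; apply Rmax_right; fold T; lra).
      apply Rle_trans with (C0 * K * (C1 + 2) * x).
      + apply (stable_RInt_small_time beta t (sigma t) HS f (C0 * K * (C1 + 2)) lambda); trivial.
        { apply Rmult_le_pos; lra. }
        intros tau Htau. apply Rle_trans with (1 := Hfu tau Htau).
        rewrite !Rmult_assoc. apply Rmult_le_compat_l; [lra|].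
        assert (Htl : 0 < tau * lambda) by now apply Rmult_lt_0_compat.
        assert (Hone : 0 <= 1 - exp (- (tau * lambda))) by (generalize (exp_neg_le1 (tau * lambda)); lra).
        destruct (Rle_dec m tau) as [H1|H1].
        * apply Rle_trans with K.
          -- apply Rle_trans with (1 := Hgd tau Htau). apply diag_kernel_large_time; lra.
          (* For [tau >= m] one has [1 - e^(-tau/m) >= 1/2]; this accounts for the 2 in [C1 + 2]. *)
          -- rewrite <- (Rmult_1_r K) at 1. apply Rmult_le_compat_l; [lra|].
             assert (H2 : 1 <= tau * lambda) by (rewrite HtlE; apply Rle_div_r; lra).
             assert (H3 : exp (- (tau * lambda)) <= exp (- (1))) by (apply exp_le; lra).
             assert (H4 := exp_neg1_le_half). nra.
        * rewrite gauss_kernel_diag, <- Hmd.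
          apply Rle_trans with (K * Rpower (m / tau) M * exp (- (m / (4 * tau)))).
          -- apply Rmult_le_compat_r. left; apply exp_pos. apply diag_kernel_small_time; lra.
          -- rewrite Rmult_assoc. apply Rmult_le_compat_l; [lra|].
             apply Rle_trans with (1 := HI m tau Hm Htau ltac:(lra)). fold lambda.
             apply Rmult_le_compat_r; lra.
      + unfold CU. assert (0 < C0 * C2 * (x * K)).
        { apply Rmult_lt_0_compat; now apply Rmult_lt_0_compat. }
        lra. }
  (* The bound uniform over compact intervals gives convergence of the integral defining [palpha],
     its upper bound, and the right to bound it below by the integral over the annulus. *)
  destruct (is_RInt_gen_nonneg_bounded (fun tau => f tau * sigma t tau) (CU * X)) as [_ [HU HL]]; trivial.
  { intros tau Htau. apply Rmult_le_pos. left; now apply Hfpos. now apply (stable_nonneg beta t). }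
  { intros a b Ha0 Hab. now apply (stable_ex_RInt_mult beta t). }
  change (RInt_gen (fun tau => f tau * sigma t tau) (at_right 0) (Rbar_locally p_infty))
    with (palpha zeta sigma t r s) in HU, HL.
  assert (HX0 : 0 < X) by (rewrite HX; now apply Rmult_lt_0_compat).
  assert (Hmass := stable_annulus_mass_ge beta t (sigma t) HS B D lambda Hb Ht HB HD HBb HDb Hl Hx1).
  fold x in Hmass.
  replace (/ (D * lambda)) with (m / D) in Hmass by (unfold lambda; field; lra).
  replace (B / lambda) with (B * m) in Hmass by (unfold lambda; field; lra).
  assert (Hp : 0 < m / D) by (apply Rdiv_lt_0_compat; lra).
  assert (HmD : m / D <= m). { apply (proj2 (Rle_div_l m m D ltac:(lra))). nra. }
  assert (Hpq : m / D <= B * m) by nra.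
  (* On the annulus [(r-s)^2 <= m < D tau], so the Gaussian factor is at least [exp (- D/4)]. The
     diagonal kernel is at least [K] before time [m] and has lost at most the factor [CB] by time
     [B m]. *)
  assert (Hlow : forall tau, m / D < tau < B * m -> K <= C0 * (CB * exp (D / 4)) * f tau).
  { intros tau Htau. assert (Htau0 : 0 < tau) by lra.
    destruct (HP r s tau Hr Hs Htau0) as [_ H]. fold (f tau) in H.
    assert (HE : 1 <= exp (D / 4) * exp (- ((r - s) ^ 2 / (4 * tau)))).
    { rewrite <- exp_plus, <- exp_0. apply exp_le.
      assert ((r - s) ^ 2 / (4 * tau) <= D / 4); [|lra].
      apply (proj2 (Rle_div_l _ _ (4 * tau) ltac:(lra))).
      assert (m < tau * D) by (apply (proj1 (Rlt_div_l m tau D ltac:(lra))); lra). lra. }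
    assert (HKd : K <= CB * diag_kernel zeta (r * s) tau).
    { assert (Hdp := diag_kernel_pos zeta (r * s) tau).
      assert (HCB1 : 1 <= CB) by (apply Rpower_ge1; lra).
      destruct (Rle_dec tau m) as [H1|H1].
      - apply Rle_trans with (diag_kernel zeta (r * s) tau); [|nra]. apply diag_kernel_large_time; lra.
      - apply Rle_trans with (diag_kernel zeta (r * s) tau * Rpower (tau / m) M).
        + apply diag_kernel_small_time; lra.
        + rewrite Rmult_comm. apply Rmult_le_compat_r; [lra|]. apply Rle_Rpower_l; [lra|].
          split. apply Rdiv_lt_0_compat; lra. apply (proj2 (Rle_div_l _ _ _ Hm)). lra. }
    rewrite gauss_kernel_diag in H.
    set (dk := diag_kernel zeta (r * s) tau) in *.
    set (E := exp (- ((r - s) ^ 2 / (4 * tau)))) in *.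
    assert (Hdk : 0 < dk) by apply diag_kernel_pos.
    apply Rle_trans with (1 := HKd).
    replace (C0 * (CB * exp (D / 4)) * f tau) with (CB * exp (D / 4) * (C0 * f tau)) by ring.
    apply Rle_trans with (CB * exp (D / 4) * (dk * E)).
    - replace (CB * exp (D / 4) * (dk * E)) with (CB * dk * (exp (D / 4) * E)) by ring.
      rewrite <- (Rmult_1_r (CB * dk)) at 1. apply Rmult_le_compat_l; trivial.
      left; now apply Rmult_lt_0_compat.
    - apply Rmult_le_compat_l; trivial. left; now apply Rmult_lt_0_compat. }
  assert (Hint : K * RInt (sigma t) (m / D) (B * m) <=
     C0 * (CB * exp (D / 4)) * RInt (fun tau => f tau * sigma t tau) (m / D) (B * m)).
  { assert (E1 := stable_ex_RInt beta t (sigma t) HS _ _ Hp Hpq).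
    assert (E2 := stable_ex_RInt_mult beta t (sigma t) HS f _ _ Hp Hpq Hf).
    assert (R1 : is_RInt (fun tau => K * sigma t tau) (m / D) (B * m) (K * RInt (sigma t) (m / D) (B * m))).
    { apply (is_RInt_scal (sigma t)), (RInt_correct (sigma t)), E1. }
    assert (R2 : is_RInt (fun tau => C0 * (CB * exp (D / 4)) * (f tau * sigma t tau)) (m / D) (B * m)
      (C0 * (CB * exp (D / 4)) * RInt (fun tau => f tau * sigma t tau) (m / D) (B * m))).
    { apply (is_RInt_scal (fun tau => f tau * sigma t tau)), (RInt_correct (fun tau => f tau * sigma t tau)), E2. }
    apply (is_RInt_le _ _ _ _ _ _ Hpq R1 R2).
    intros tau Htau. rewrite <- Rmult_assoc. apply Rmult_le_compat_r.
    - apply (stable_nonneg beta t (sigma t) HS). lra.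
    - now apply Hlow. }
  assert (HLp := HL _ _ Hp Hpq).
  assert (HXp : X <= CL * palpha zeta sigma t r s).
  { rewrite HX. unfold CL.
    apply (Rmult_le_compat_l K) in Hmass; [|lra].
    assert (HCC : 0 < C0 * (CB * exp (D / 4))).
    { apply Rmult_lt_0_compat; trivial. now apply Rmult_lt_0_compat. }
    apply (Rmult_le_compat_l (C0 * (CB * exp (D / 4)))) in HLp; [|lra]. lra. }
  assert (Hpp : 0 < palpha zeta sigma t r s) by (apply (Rmult_lt_reg_l CL); lra).
  split; nra.
Qed.

Theorem theorem2p1 (zeta : R) (hzeta : -1/2 < zeta) :
  (exists c1 c2 c3 c4 c5 c6 c7 c8 : R,
     0 < c1 /\ 0 < c2 /\ 0 < c3 /\ 0 < c4 /\ 0 < c5 /\ 0 < c6 /\ 0 < c7 /\ 0 < c8 /\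
     forall r s t : R, 0 < r -> 0 < s -> 0 < t ->
       c1 * Rpower t (- (1/2)) * exp (- ((r - s) ^ 2 / (c2 * t))) / Rpower (r * s + t) zeta
         <= p2 zeta t r s /\
       p2 zeta t r s
         <= c3 * Rpower t (- (1/2)) * exp (- ((r - s) ^ 2 / (c4 * t))) / Rpower (r * s + t) zeta /\
       c5 * Azeta zeta t r s * exp (- ((r - s) ^ 2 / (c6 * t))) <= p2 zeta t r s /\
       p2 zeta t r s <= c7 * Azeta zeta t r s * exp (- ((r - s) ^ 2 / (c8 * t)))) /\
  (forall alpha : R, 0 < alpha < 2 ->
     exists K : R, 1 <= K /\
       forall sigma : R -> R -> R, stable_subordinator_density alpha sigma ->
       forall r s t : R, 0 < r -> 0 < s -> 0 < t ->
         / K * Qalpha zeta alpha t r s <= palpha zeta sigma t r s /\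
         palpha zeta sigma t r s <= K * Qalpha zeta alpha t r s).
Proof.
  split; [now apply p2_bounds|].
  intros alpha Ha.
  destruct (Qalpha_compare zeta alpha hzeta ltac:(lra)) as [C1 [HC1 H1]].
  destruct (palpha_scale_bounds zeta alpha hzeta Ha) as [C2 [HC2 H2]].
  assert (HC : 0 < C1 * C2) by now apply Rmult_lt_0_compat.
  exists (1 + C1 * C2). split; [lra|].
  intros sigma Hsig r s t Hr Hs Ht.
  destruct (H1 r s t Hr Hs Ht) as [HQ1 HQ2].
  destruct (H2 sigma Hsig r s t Hr Hs Ht) as [HP1 HP2].
  set (X := t * Rpower (subord_scale alpha t r s) (- (alpha / 2)) *
    diag_kernel zeta (r * s) (subord_scale alpha t r s)) in *.
  assert (HX : 0 < X).
  { apply Rmult_lt_0_compat; [|apply diag_kernel_pos].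
    apply Rmult_lt_0_compat; trivial. apply Rpower_pos. }
  set (Q := Qalpha zeta alpha t r s) in *. set (p := palpha zeta sigma t r s) in *.
  assert (HQ : 0 < Q) by (apply (Rmult_lt_reg_l C1); lra).
  assert (Hp : 0 < p) by (apply (Rmult_lt_reg_l C2); lra).
  apply (Rmult_le_compat_l C1) in HP2; [|lra]. apply (Rmult_le_compat_l C2) in HQ2; [|lra].
  split.
  - apply (Rmult_le_reg_l (1 + C1 * C2)); [lra|]. rewrite <- Rmult_assoc, Rinv_r by lra. lra.
  - lra.
Qed.
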